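(* Let $F$ be a field, let $A$ be a finitely generated free abelian group, and let $F * A$ be a twisted group algebra of $A$ over $F$ (an $n$-dimensional quantum torus, $n=\operatorname{rk}(A)$) whose center is $F$. Let $M$ be a nonzero finitely generated $F * A$-module. Let $C < A$ be a (proper) subgroup having a subgroup $C_0$ of finite index such that the subalgebra $F * C_0$ is commutative. If $M$ is finitely generated as an $F * C$-module, then: (i) $\operatorname{GKdim}(M) = \operatorname{rk}(C)$; (ii) $M$ is $F * C$-torsion-free; (iii) $M$ has finite length as an $F * A$-module; (iv) $M$ is cyclic as an $F * A$-module.
   Context: A twisted group algebra $F * A$ of a finitely generated free abelian group $A$ over a field $F$ is an associative unital $F$-algebra with an $F$-basis $\overline{A} = \{\bar a : a \in A\}$ that is a copy of $A$, with multiplication satisfying $\bar a_1 \bar a_2 = \tau(a_1,a_2)\,\overline{a_1a_2}$ for all $a_1,a_2 \in A$, where $\tau : A \times A \to F^* = F\setminus\{0\}$ satisfies $\tau(a_1,a_2)\tau(a_1a_2,a_3) = \tau(a_2,a_3)\tau(a_1,a_2a_3)$. The $n$-dimensional quantum torus, i.e. the $F$-algebra generated by $x_1,\dots,x_n$ and their inverses subject to $x_ix_j = q_{ij}x_jx_i$ with $q_{ij} \in F^*$, has this structure with $\operatorname{rk}(A) = n$. For a subgroup $B \le A$, $F * B$ denotes the subalgebra consisting of the elements $\sum_{a} \lambda_a \bar a$ of $F * A$ with $\lambda_a = 0$ for $a \notin B$. $\operatorname{rk}$ denotes the (torsion-free) rank of an abelian group. ''Center $F$'' means that the center consists exactly of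 the scalars $F\cdot 1$. Modules are right modules. $\operatorname{GKdim}(M)$ is the Gelfand–Kirillov dimension of $M$ as an $F * A$-module; for finitely generated $M$ it equals the supremum of the ranks of the subgroups $B \le A$ such that $M$ is not $F * B$-torsion. The $F * C$-torsion submodule of $M$ is $\{m \in M : m x = 0 \text{ for some } x \in F * C \setminus\{0\}\}$; $M$ is $F * C$-torsion if this is all of $M$, and $F * C$-torsion-free if this is $0$. *)

(* Defs.v *)
From HB Require Import structures.
From mathcomp Require Import all_boot all_order all_algebra.
From mathcomp Require Import all_classical all_reals all_analysis.

Set Implicit Arguments.
Unset Strict Implicit.
Unset Printing Implicit Defensive.

Import Order.TTheory GRing.Theory Num.Theory.

Local Open Scope classical_set_scope.
Local Open Scope ring_scope.

(* In lin_span, lin_indep, vdim and fin_gen the scalars are restricted to a set S,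
   in practice a subring of K.  The same notions then serve for modules over
   F * A, for modules over a subalgebra F * C and for F-vector spaces, without
   restricting the module structure to the subring. *)
Section LinearAlgebra.
Variables (K : pzRingType) (V : lmodType K).
Implicit Types (S : set K) (X N : set V).

Definition lin_span S X : set V :=
  [set v | exists s : seq (K * V),
     (forall p, p \in s -> S p.1 /\ X p.2) /\ v = \sum_(p <- s) p.1 *: p.2].

Definition lin_indep S (I : choiceType) (v : I -> V) : Prop :=
  forall (s : seq I) (c : I -> K), uniq s ->
    (forall i, i \in s -> S (c i)) ->
    \sum_(i <- s) c i *: v i = 0 -> forall i, i \in s -> c i = 0.

Definition is_basis (I : choiceType) (v : I -> V) : Prop :=
  lin_indep setT v /\ lin_span setT (range v) = setT.

Definition fin_gen S N : Prop := exists2 X, finite_set X & N = lin_span S X.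

Definition is_submodule N : Prop :=
  [/\ N 0, (forall x y, N x -> N y -> N (x + y))
    & (forall a x, N x -> N (a *: x))].

(* A composition series: each term is a maximal proper submodule of the next. *)
Definition finite_length : Prop :=
  exists (l : nat) (N : nat -> set V),
    [/\ N 0%N = [set 0], N l = setT,
        (forall i, (i <= l)%N -> is_submodule (N i))
      & (forall i, (i < l)%N ->
           [/\ N i `<=` N i.+1, N i <> N i.+1
             & forall P, is_submodule P -> N i `<=` P -> P `<=` N i.+1 ->
                 P = N i \/ P = N i.+1])].

Definition cyclic_module : Prop := exists m : V, lin_span setT [set m] = setT.

End LinearAlgebra.

Arguments finite_length {K} V.
Arguments cyclic_module {K} V.

Definition vdim (R : realType) (K : pzRingType) (V : lmodType K)
    (S : set K) (X : set V) : \bar R :=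
  ereal_sup [set d | exists k (v : 'I_k -> V),
    [/\ (forall i, X (v i)), lin_indep S v & d = (k%:R)%:E]].

Section AbelianGroups.
Variable A : zmodType.
Implicit Types B C : set A.

Definition is_subgroup B : Prop := B 0 /\ forall a b, B a -> B b -> B (a - b).

Definition fg_free_abelian : Prop :=
  exists n (e : 'I_n -> zmodule A), is_basis e.

Definition rk (R : realType) B : \bar R :=
  vdim R (V := zmodule A) setT B.

Definition finite_index C B : Prop :=
  finite_set [set [set c + b | b in B] | c in C].

End AbelianGroups.

Arguments fg_free_abelian A : clear implicits.

Section TwistedGroupAlgebra.
Variables (F : fieldType) (A : zmodType) (FA : algType F).

(* The group A is written additively. *)
Definition twisted_group_algebra (bar : A -> FA) (tau : A -> A -> F) : Prop :=
  [/\ is_basis bar,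
      (forall a b, tau a b != 0),
      (forall a b, bar a * bar b = tau a b *: bar (a + b))
    & (forall a b c, tau a b * tau (a + b) c = tau b c * tau a (b + c))].

Definition subalg (bar : A -> FA) (B : set A) : set FA :=
  lin_span setT (bar @` B).

Definition scalars : set FA := range (fun l : F => l%:A).

Definition alg_center : set FA := [set x | forall y, x * y = y * x].

End TwistedGroupAlgebra.

Arguments scalars {F} FA.
Arguments alg_center {F} FA.

(* Right FA-modules are left modules over the converse ring FA^c. *)
Section RightModules.
Variables (F : fieldType) (FA : algType F) (M : lmodType FA^c).

Definition ract (m : M) (x : FA) : M := (x : FA^c) *: m.

(* The product of an F-subspace W of M and an F-subspace V of FA. *)
Definition subspace_mul (W : set M) (V : set FA) : set M :=
  lin_span (scalars FA : set FA^c) [set m | exists w v, [/\ W w, V v & m = ract w v]].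

(* limsup_n log_n (dim_F (W V^n)); the terms n = 0, 1 are irrelevant. *)
Definition growth (R : realType) (W : set M) (V : set FA) : \bar R :=
  limn_esup (fun n : nat =>
    (lne (vdim R (scalars FA : set FA^c)
            (iter n (fun U => subspace_mul U V) W))
       * ((ln n%:R)^-1)%:E)%E).

(* The supremum is over the finite-dimensional F-subspaces V of FA containing 1
   and the finite-dimensional F-subspaces W of M. *)
Definition GKdim (R : realType) : \bar R :=
  ereal_sup [set g | exists (V : set FA) (W : set M),
    [/\ fin_gen (setT : set F) V, V 1, fin_gen (scalars FA : set FA^c) W
      & g = growth R W V]].

Definition torsion (S : set FA) : set M :=
  [set m | exists x : FA, [/\ S x, x != 0 & ract m x = 0]].

Definition torsion_free (S : set FA) : Prop := torsion S = [set 0].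

End RightModules.

Arguments torsion {F FA} M S.
Arguments torsion_free {F FA} M S.
Arguments GKdim {F FA} M R.

(* Main.v *)
(* Write B for the finite index subgroup of C with F * B commutative; it is free
   with a finite basis, and M is finitely generated over the domain F * B.

   An ideal of F * B which is stable under conjugation by the elements bar a is 0
   or everything: an element of minimal support, translated so that its support
   contains 0, differs from each of its conjugates by an element of smaller
   support, so it is central, hence a scalar.  Given an F * A-submodule N, the
   elements of M which are F * B-torsion modulo N are all sent into N by one
   nonzero element of F * B, because M is finitely generated.  The elements of
   F * B with this property form a stable ideal, so N is pure in M over F * B.
   For N = 0 this says that M is torsion-free over F * B, and over F * C because
   every nonzero element of F * C has a nonzero right multiple in F * B.

   Elements chosen in the successive differences of a strict chain of pure
   submodules are F * B-independent, so the length of such chains is bounded by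
   the number of generators of M; a longest chain is a composition series.

   For cyclicity, A / B is not torsion, since otherwise a multiple of A would be
   central; hence the infinitely many cosets of B force every t in M to be killed
   by some r <> 0.  Going down the composition series, suppose that t generates M
   modulo N_(i+1).  As F * A is simple, there is s in N_(i+1) with s r not in N_i,
   and then t + s generates M modulo N_i.

   For the Gelfand-Kirillov dimension, conjugation preserves supports, so M is
   spanned by boxes in which right multiplication by V^n moves by O(n): this gives
   O(n^r) with r = rk B.  The lower bound comes from the free module t (F * B). *)

Require Import Defs.
From HB Require Import structures.
From mathcomp Require Import all_boot all_order all_algebra.
From mathcomp Require Import all_classical all_reals all_analysis.

Set Implicit Arguments.
Unset Strict Implicit.
Unset Printing Implicit Defensive.

Import Order.TTheory GRing.Theory Num.Theory.
Local Open Scope classical_set_scope.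
Local Open Scope ring_scope.

(** * Linear dependence over commutative subdomains *)

(** A predicate on subsets of a possibly noncommutative ring: it covers F * B and the scalars inside
    [FA^c], and also the whole of [int]. *)
Definition comm_subdomain (K : nzRingType) (S : set K) : Prop :=
  [/\ S 1, (forall x y, S x -> S y -> S (x - y)),
      (forall x y, S x -> S y -> S (x * y)),
      (forall x y, S x -> S y -> x * y = y * x)
    & (forall x y, S x -> S y -> x * y = 0 -> x = 0 \/ y = 0)].

Section CommSubdomain.
Variables (K : nzRingType) (S : set K).
Hypothesis hS : comm_subdomain S.

Lemma subdom1 : S 1. Proof. by case: hS. Qed.
Lemma subdomB x y : S x -> S y -> S (x - y). Proof. by case: hS => _ + _ _ _; apply. Qed.
Lemma subdom0 : S 0.
Proof. by rewrite -(subrr 1); apply: subdomB; exact: subdom1. Qed.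
Lemma subdomN x : S x -> S (- x).
Proof. by rewrite -sub0r; apply: subdomB; exact: subdom0. Qed.
Lemma subdomD x y : S x -> S y -> S (x + y).
Proof. by move=> Sx Sy; rewrite -[y]opprK; apply: subdomB => //; exact: subdomN. Qed.
Lemma subdomM x y : S x -> S y -> S (x * y). Proof. by case: hS => _ _ + _ _; apply. Qed.
Lemma subdomC x y : S x -> S y -> x * y = y * x.
Proof. by case: hS => _ _ _ + _; apply. Qed.
Lemma subdom_eq0 x y : S x -> S y -> x * y = 0 -> x = 0 \/ y = 0.
Proof. by case: hS => _ _ _ _; apply. Qed.
Lemma subdom_sum (I : Type) (r : seq I) (P : pred I) (f : I -> K) :
  (forall i, P i -> S (f i)) -> S (\sum_(i <- r | P i) f i).
Proof. by move=> h; elim/big_rec: _ => [|i x /h]; [exact: subdom0|exact: subdomD]. Qed.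

(** Fraction-free elimination, by induction on the number k of equations: cross-multiplying with a
    pivot removes one equation and one unknown. Without zero divisors, scaling the smaller solution
    by the pivot keeps it nonzero. *)
Lemma homogeneous_system k l (c : 'I_l -> 'I_k -> K) : (k < l)%N ->
  (forall i j, S (c i j)) ->
  exists x : 'I_l -> K, [/\ (forall i, S (x i)), (exists i, x i <> 0)
    & forall j, \sum_i x i * c i j = 0].
Proof.
elim: k l c => [|k IH] [//|l] c ltkl hc.
  exists (fun=> 1); split; [by move=> _; exact: subdom1| |by case].
  by exists ord0; apply/eqP; rewrite oner_neq0.
(* If all coefficients of the first equation vanish, it can simply be dropped. *)
case: (pselect (exists i, c i ord0 <> 0)) => [[i0 ci0]|nz]; last first.
  have [x [Sx x0 hx]] := IH l.+1 (fun i j => c i (lift ord0 j)) (ltnW ltkl) (fun i j => hc _ _).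
  exists x; split=> // j; case: (unliftP ord0 j) => [j' ->|->]; first exact: hx.
  apply: big1 => i _; have [->|ci] := pselect (c i ord0 = 0); first by rewrite mulr0.
  by case: nz; exists i.
set p := c i0 ord0.
pose c' (i : 'I_l) (j : 'I_k) :=
  p * c (lift i0 i) (lift ord0 j) - c (lift i0 i) ord0 * c i0 (lift ord0 j).
have [x [Sx [i1 xi1] hx]] : exists x : 'I_l -> K, [/\ (forall i, S (x i)),
    (exists i, x i <> 0) & forall j, \sum_i x i * c' i j = 0].
  by apply: IH => // i j; apply: subdomB; apply: subdomM; exact: hc.
(* Once the other entries are scaled by [p], the first equation dictates the entry at [i0]. *)
pose y i := if unlift i0 i is Some i' then x i' * p
            else - \sum_i' x i' * c (lift i0 i') ord0.
have yl i : y (lift i0 i) = x i * p by rewrite /y liftK.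
have yi : y i0 = - \sum_i' x i' * c (lift i0 i') ord0 by rewrite /y unlift_none.
have Sp : S p by exact: hc.
exists y; split.
- move=> i; case: (unliftP i0 i) => [i' ->|->]; first by rewrite yl; apply: subdomM.
  by rewrite yi; apply: subdomN; apply: subdom_sum => i' _; apply: subdomM.
- by exists (lift i0 i1) => yi1; case: (@subdom_eq0 (x i1) p) => //; rewrite -yl.
move=> j; rewrite (bigD1_ord i0) //= yi.
under eq_bigr do rewrite yl.
rewrite mulNr mulr_suml; apply/eqP; rewrite addrC subr_eq0; apply/eqP.
case: (unliftP ord0 j) => [j' ->|->]; last first.
  by apply: eq_bigr => i _; rewrite -!mulrA; congr (_ * _); apply: subdomC.
apply/eqP; rewrite -subr_eq0 -sumrB; apply/eqP; rewrite -[RHS](hx j').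
by apply: eq_bigr => i _; rewrite /c' mulrBr !mulrA.
Qed.

Variable V : lmodType K.

(** Unlike in [lin_span], each generator carries exactly one coefficient, so that a vector becomes a
    row of a linear system. *)
Definition fspan (T : finType) (m : T -> V) : set V :=
  [set v | exists c : T -> K, (forall t, S (c t)) /\ v = \sum_t c t *: m t].

Lemma fspan_dep (T : finType) (m : T -> V) l (v : 'I_l -> V) : (#|T| < l)%N ->
  (forall i, fspan m (v i)) ->
  exists x : 'I_l -> K, [/\ (forall i, S (x i)), (exists i, x i <> 0)
    & \sum_i x i *: v i = 0].
Proof.
move=> ltl hv.
have [c hc] := choice hv.
have [x [Sx x0 hx]] := @homogeneous_system _ _ (fun i (j : 'I_#|T|) => c i (enum_val j)) ltl
  (fun i j => (hc i).1 _).
exists x; split=> //.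
transitivity (\sum_i \sum_t (x i * c i t) *: m t).
  by apply: eq_bigr => i _; rewrite (hc i).2 scaler_sumr; apply: eq_bigr => t _; rewrite scalerA.
rewrite exchange_big big1 //= => t _; rewrite -scaler_suml.
by have := hx (enum_rank t); rewrite enum_rankK => ->; rewrite scale0r.
Qed.

Lemma vdim_le (R : realType) (T : finType) (m : T -> V) (X : set V) :
  X `<=` fspan m -> (vdim R S X <= (#|T|%:R)%:E)%E.
Proof.
move=> hX; apply: ge_ereal_sup => _ /= [k [v [Xv hv ->]]].
rewrite lee_fin ler_nat leqNgt; apply/negP => ltk.
have [x [Sx [i xi] hx]] := @fspan_dep _ m _ v ltk (fun i => hX _ (Xv i)).
by apply: xi; apply: (hv (index_enum _) x) => //; [exact: index_enum_uniq|exact: mem_index_enum].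
Qed.

End CommSubdomain.

Lemma vdim_ge (R : realType) (K : pzRingType) (V : lmodType K) (S : set K) (X : set V)
    k (v : 'I_k -> V) :
  (forall i, X (v i)) -> lin_indep S v -> ((k%:R)%:E <= vdim R S X)%E.
Proof. by move=> hX hv; apply: ereal_sup_ubound => /=; exists k, v. Qed.

Lemma lin_indepP (K : pzRingType) (V : lmodType K) (S : set K) (T : finType) (v : T -> V) :
  S 0 ->
  lin_indep S v <->
  (forall x, (forall i, S (x i)) -> \sum_i x i *: v i = 0 -> forall i, x i = 0).
Proof.
move=> S0; split=> [h x Sx hx i|h s c us Sc hc i si].
  by apply: (h (index_enum _) x) => //; [exact: index_enum_uniq|exact: mem_index_enum].
pose d j := if j \in s then c j else 0.
have : d i = 0.
  apply: (h d) => [j|]; first by rewrite /d; case: ifP => // /Sc.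
  rewrite -[RHS]hc [RHS]big_uniq //= [RHS]big_mkcond /=.
  apply: eq_bigr => j _; rewrite /d.
  by case: (boolP (j \in s)) => //; rewrite scale0r.
by rewrite /d si.
Qed.

Lemma lin_span_ind (K : pzRingType) (V : lmodType K) (S : set K) (X : set V)
    (P : V -> Prop) :
  P 0 -> (forall u v, P u -> P v -> P (u + v)) ->
  (forall a x, S a -> X x -> P (a *: x)) -> forall v, lin_span S X v -> P v.
Proof.
move=> P0 PD PZ v [s [hs ->]]; rewrite big_seq; elim/big_rec: _ => // p u /hs [Sp Xp].
by apply: PD; exact: PZ.
Qed.

Section Span.
Variables (K : nzRingType) (V : lmodType K) (S : set K).
Hypotheses (S0 : S 0) (SD : forall x y, S x -> S y -> S (x + y)).

Lemma fspanD (T : finType) (m : T -> V) u v :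
  fspan S m u -> fspan S m v -> fspan S m (u + v).
Proof.
move=> [c [Sc ->]] [d [Sd ->]]; exists (fun t => c t + d t); split=> [t|].
  exact: SD.
by rewrite -big_split; apply: eq_bigr => t _; rewrite scalerDl.
Qed.

Lemma fspan_term (T : finType) (m : T -> V) x t : S x -> fspan S m (x *: m t).
Proof.
move=> Sx; exists (fun u => if u == t then x else 0); split=> [u|]; first by case: ifP.
rewrite (bigD1 t) //= eqxx big1 ?addr0 // => u /negPf ->.
by rewrite scale0r.
Qed.

Lemma fspan0 (T : finType) (m : T -> V) : fspan S m 0.
Proof. by exists (fun=> 0); split=> //; rewrite big1 // => i _; rewrite scale0r. Qed.

Lemma fspan_sum (T : finType) (m : T -> V) (I : Type) (r : seq I) (P : pred I) (f : I -> V) :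
  (forall i, P i -> fspan S m (f i)) -> fspan S m (\sum_(i <- r | P i) f i).
Proof. by move=> h; elim/big_rec: _ => [|i x /h]; [exact: fspan0|exact: fspanD]. Qed.

Lemma lin_span_fspan (T : finType) (m : T -> V) (X : set V) :
  X `<=` range m -> lin_span S X `<=` fspan S m.
Proof.
move=> hX; apply: lin_span_ind; [exact: fspan0|exact: fspanD|move=> a x Sa /hX [t _ <-]].
exact: fspan_term.
Qed.

Lemma fspan_lin_span (T : finType) (m : T -> V) (X : set V) :
  range m `<=` X -> fspan S m `<=` lin_span S X.
Proof.
move=> hX _ [c [Sc ->]]; exists [seq (c i, m i) | i <- index_enum T].
split; last by rewrite big_map.
by move=> p /mapP [i _ ->]; split; [exact: Sc|apply: hX; exists i].
Qed.

Lemma fin_gen_fspan (N : set V) :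
  fin_gen S N -> exists k (m : 'I_k -> V), N = fspan S m.
Proof.
move=> [X /finite_seqP [xs ->] ->].
exists (size xs), (fun i => nth 0 xs i); apply/seteqP; split.
  apply: lin_span_fspan => x /= /(nthP 0) [i lti <-].
  by exists (Ordinal lti).
by apply: fspan_lin_span => _ [i _ <-]; exact: mem_nth.
Qed.

End Span.

(** * Coefficients in a twisted group algebra *)

Section Coefficients.
Variables (F : fieldType) (A : zmodType) (FA : algType F) (bar : A -> FA).

(** Since c has to vanish off s, it is determined by x, although s is not. *)
Definition fin_expansion (x : FA) (s : seq A) (c : A -> F) : Prop :=
  [/\ uniq s, (forall a, a \notin s -> c a = 0) & x = \sum_(a <- s) c a *: bar a].

(** For a basis, [fin_expansion_unique] makes this choice well defined and [fin_expansion_ex]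
    ensures that the default 0 is never taken. *)
Definition bcoef (x : FA) (a : A) : F :=
  xget 0 [set l | exists s c, fin_expansion x s c /\ c a = l].

Hypothesis bar_basis : is_basis bar.

Lemma sum_supp (s s' : seq A) (c : A -> F) : uniq s -> uniq s' ->
  (forall a, a \notin s -> c a = 0) -> {subset s <= s'} ->
  \sum_(a <- s') c a *: bar a = \sum_(a <- s) c a *: bar a.
Proof.
move=> us us' hc ss'; rewrite (bigID (mem s)) /= [X in _ + X]big1 ?addr0; last first.
  by move=> a /hc ->; rewrite scale0r.
rewrite -big_filter; apply: perm_big; apply: uniq_perm => //; first exact: filter_uniq.
by move=> a; rewrite mem_filter /=; case: (boolP (a \in s)) => // /ss' ->.
Qed.

Lemma fin_expansion_unique x s c s' c' :
  fin_expansion x s c -> fin_expansion x s' c' -> c = c'.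
Proof.
move=> [us hc xE] [us' hc' xE']; apply/funext => a.
have [as_|] := boolP (a \in undup (s ++ s')); last first.
  by rewrite mem_undup mem_cat negb_or => /andP[/hc -> /hc' ->].
apply/eqP; rewrite -subr_eq0; apply/eqP.
apply: (bar_basis.1 (undup (s ++ s')) (fun a => c a - c' a)) => //.
  exact: undup_uniq.
under eq_bigr do rewrite scalerBl.
rewrite sumrB (sum_supp us (undup_uniq _) hc) ?(sum_supp us' (undup_uniq _) hc').
- by rewrite -xE -xE' subrr.
- by move=> b bs; rewrite mem_undup mem_cat bs orbT.
- by move=> b bs; rewrite mem_undup mem_cat bs.
Qed.

Lemma fin_expansionD x y s t c d : fin_expansion x s c -> fin_expansion y t d ->
  fin_expansion (x + y) (undup (s ++ t)) (fun a => c a + d a).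
Proof.
move=> [us hc ->] [ut hd ->]; split; first exact: undup_uniq.
  by move=> a; rewrite mem_undup mem_cat negb_or => /andP[/hc -> /hd ->]; rewrite addr0.
under [RHS]eq_bigr do rewrite scalerDl.
rewrite big_split /= (sum_supp us (undup_uniq _) hc) ?(sum_supp ut (undup_uniq _) hd) //.
- by move=> b bs; rewrite mem_undup mem_cat bs orbT.
- by move=> b bs; rewrite mem_undup mem_cat bs.
Qed.

Lemma fin_expansion_bar l a : fin_expansion (l *: bar a) [:: a] (fun b => l *+ (b == a)).
Proof.
split=> // [b|]; first by rewrite inE => /negPf ->.
by rewrite big_seq1 eqxx.
Qed.

Lemma fin_expansion_ex x : exists s c, fin_expansion x s c.
Proof.
have : lin_span setT (range bar) x by rewrite bar_basis.2.
move=> [s [hs ->]]; elim: s hs => [|[l v] s IH] hs.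
  by exists [::], (fun=> 0); split=> //; rewrite !big_nil.
have [|t [c htc]] := IH; first by move=> p ps; apply: hs; rewrite inE ps orbT.
have [_ [a _ /= <-]] := hs (l, v) (mem_head _ _).
rewrite big_cons /=; do 2!eexists; exact: (fin_expansionD (fin_expansion_bar l a) htc).
Qed.

Lemma bcoefE x s c : fin_expansion x s c -> bcoef x = c.
Proof.
move=> h; apply/funext => a; rewrite /bcoef.
case: xgetP => [l -> [s' [c' [/(fin_expansion_unique h) -> ->]]]//|].
by move=> /(_ (c a)) [] /=; exists s, c.
Qed.

(** The chosen expansion may list zero coefficients; the filter leaves the exact support. *)
Definition supp x : seq A :=
  let s := xget [::] [set s | exists c, fin_expansion x s c] in
  [seq a <- s | bcoef x a != 0].

Lemma bcoef_supp x : fin_expansion x (supp x) (bcoef x).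
Proof.
rewrite /supp; case: xgetP => [s -> [c h]|/=]; last first.
  by have [s [c h]] := fin_expansion_ex x; move/(_ s); case; exists c.
rewrite (bcoefE h); have [us hc xE] := h; split; first exact: filter_uniq.
  move=> a; rewrite mem_filter negb_and negbK => /orP[/eqP //|]; exact: hc.
rewrite {1}xE; apply: sum_supp => //; first exact: filter_uniq.
  by move=> a; rewrite mem_filter negb_and negbK => /orP[/eqP //|]; exact: hc.
by move=> a; rewrite mem_filter => /andP[].
Qed.

Lemma mem_supp x a : (a \in supp x) = (bcoef x a != 0).
Proof.
rewrite /supp mem_filter; case: eqP => //= /eqP ca; case: xgetP => [s _ [c h]|/=].
  have [_ hc _] := h.
  by apply/negPn/negP => /hc; rewrite -(bcoefE h) => /eqP; rewrite (negPf ca).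
by have [s [c h]] := fin_expansion_ex x; move/(_ s); case; exists c.
Qed.

Lemma supp_sum x : x = \sum_(a <- supp x) bcoef x a *: bar a.
Proof. by case: (bcoef_supp x). Qed.

Lemma supp_uniq x : uniq (supp x). Proof. by case: (bcoef_supp x). Qed.

Lemma bcoefD x y a : bcoef (x + y) a = bcoef x a + bcoef y a.
Proof. by rewrite (bcoefE (fin_expansionD (bcoef_supp x) (bcoef_supp y))). Qed.

Lemma bcoefZbar l a b : bcoef (l *: bar a) b = l *+ (b == a).
Proof. by rewrite (bcoefE (fin_expansion_bar l a)). Qed.

Lemma bcoef_bar a b : bcoef (bar a) b = (b == a)%:R.
Proof. by rewrite -[bar a]scale1r bcoefZbar. Qed.

Lemma bcoef0 a : bcoef 0 a = 0.
Proof. by rewrite -(scale0r (bar a)) bcoefZbar mul0rn. Qed.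

Lemma bcoefZ l x a : bcoef (l *: x) a = l * bcoef x a.
Proof.
have [us hc xE] := bcoef_supp x.
rewrite (@bcoefE _ (supp x) (fun a => l * bcoef x a)) //; split=> // [b /hc -> | ].
  by rewrite mulr0.
by rewrite {1}xE scaler_sumr; apply: eq_bigr => b _; rewrite scalerA.
Qed.

Lemma bcoefN x a : bcoef (- x) a = - bcoef x a.
Proof. by rewrite -scaleN1r bcoefZ mulN1r. Qed.

Lemma bcoefB x y a : bcoef (x - y) a = bcoef x a - bcoef y a.
Proof. by rewrite bcoefD bcoefN. Qed.

Lemma bcoef_sum (I : Type) (r : seq I) (P : pred I) (f : I -> FA) a :
  bcoef (\sum_(i <- r | P i) f i) a = \sum_(i <- r | P i) bcoef (f i) a.
Proof. by apply: (big_morph (bcoef^~ a)); [move=> x y; exact: bcoefD|exact: bcoef0]. Qed.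

Lemma bcoef_inj x y : (forall a, bcoef x a = bcoef y a) -> x = y.
Proof.
move=> h; apply/eqP; rewrite -subr_eq0 [_ - _]supp_sum; apply/eqP; apply: big1 => a _.
by rewrite bcoefB h subrr scale0r.
Qed.

Lemma bcoef_neq0 x : x <> 0 -> exists a, bcoef x a != 0.
Proof.
move=> x0; apply: contrapT => h; apply: x0; apply: bcoef_inj => a; rewrite bcoef0.
by apply/eqP/negPn/negP => ca; apply: h; exists a.
Qed.

Lemma subalgP (B : set A) x : subalg bar B x <-> forall a, bcoef x a != 0 -> B a.
Proof.
split=> [[s [hs ->]] a|h].
  apply: contraPP => nBa; apply/negP; rewrite negbK bcoef_sum big_seq big1 // => p /hs.
  move=> [_ [b Bb <-]]; rewrite bcoefZbar; case: eqP => // ab.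
  by case: nBa; rewrite ab.
exists [seq (bcoef x a, bar a) | a <- supp x]; split.
  move=> p /mapP[a asx ->]; split=> //=; exists a => //.
  by apply: h; rewrite -mem_supp.
by rewrite big_map; exact: supp_sum.
Qed.

Lemma subalg_bar (B : set A) a : B a -> subalg bar B (bar a).
Proof.
move=> Ba; apply/subalgP => b; rewrite bcoef_bar.
by case: (b =P a) => [-> //|_]; rewrite eqxx.
Qed.

Lemma subalg0 (B : set A) : subalg bar B 0.
Proof. by apply/subalgP => a; rewrite bcoef0 eqxx. Qed.

Lemma subalgZ (B : set A) l x : subalg bar B x -> subalg bar B (l *: x).
Proof.
by move=> /subalgP h; apply/subalgP => a; rewrite bcoefZ mulf_eq0 negb_or => /andP[_ /h].
Qed.

Lemma subalgD (B : set A) x y : subalg bar B x -> subalg bar B y -> subalg bar B (x + y).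
Proof.
move=> /subalgP hx /subalgP hy; apply/subalgP => a; rewrite bcoefD.
have [xa|/hx //] := eqVneq (bcoef x a) 0.
by rewrite xa add0r => /hy.
Qed.

Lemma subalgB (B : set A) x y : subalg bar B x -> subalg bar B y -> subalg bar B (x - y).
Proof. by move=> hx hy; rewrite -scaleN1r; apply: subalgD => //; exact: subalgZ. Qed.

Lemma subalg_sum (B : set A) (I : Type) (r : seq I) (P : pred I) (f : I -> FA) :
  (forall i, P i -> subalg bar B (f i)) -> subalg bar B (\sum_(i <- r | P i) f i).
Proof. by move=> h; elim/big_rec: _ => [|i x /h]; [exact: subalg0|exact: subalgD]. Qed.

Lemma subalgS (B C : set A) x : B `<=` C -> subalg bar B x -> subalg bar C x.
Proof. by move=> BC /subalgP h; apply/subalgP => a /h /BC. Qed.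

Lemma subalg_full x : subalg bar setT x.
Proof. by apply/subalgP. Qed.

Lemma subalg_ind (B : set A) (P : FA -> Prop) :
  P 0 -> (forall x y, P x -> P y -> P (x + y)) ->
  (forall l a, B a -> P (l *: bar a)) -> forall x, subalg bar B x -> P x.
Proof.
move=> P0 PD Pb x /subalgP h; rewrite (supp_sum x) big_seq.
by elim/big_rec: _ => // a y; rewrite mem_supp => /h Ba Py; apply: PD => //; exact: Pb.
Qed.

End Coefficients.

(** * Supports, conjugation and invariant ideals *)

Section Subgroups.
Variables (A : zmodType) (B : set A).
Hypothesis hB : is_subgroup B.

Lemma subgroupN a : B a -> B (- a).
Proof. by move=> Ba; rewrite -sub0r; apply: hB.2 => //; exact: hB.1. Qed.

Lemma subgroupD a b : B a -> B b -> B (a + b).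
Proof. by move=> Ba Bb; rewrite -[b]opprK; apply: hB.2 => //; exact: subgroupN. Qed.

Lemma subgroup_sum (I : Type) (r : seq I) (P : pred I) (f : I -> A) :
  (forall i, P i -> B (f i)) -> B (\sum_(i <- r | P i) f i).
Proof. by move=> h; elim/big_rec: _ => [|i x /h]; [exact: hB.1|exact: subgroupD]. Qed.

Lemma subgroupMn a n : B a -> B (a *+ n).
Proof.
by move=> Ba; elim: n => [|n IH]; [exact: hB.1|rewrite mulrS; exact: subgroupD].
Qed.

Lemma subgroupMz a (z : int) : B a -> B (a *~ z).
Proof.
by move=> Ba; case: z => n; [exact: subgroupMn|apply: subgroupN; exact: subgroupMn].
Qed.

End Subgroups.

Section Twisted.
Variables (F : fieldType) (A : zmodType) (FA : algType F).
Variables (bar : A -> FA) (tau : A -> A -> F).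
Hypothesis hFA : twisted_group_algebra bar tau.

Let bb : is_basis bar. Proof. by case: hFA. Qed.

Lemma tau_neq0 a b : tau a b != 0. Proof. by case: hFA. Qed.
Lemma barM a b : bar a * bar b = tau a b *: bar (a + b). Proof. by case: hFA. Qed.
Lemma cocycle a b c : tau a b * tau (a + b) c = tau b c * tau a (b + c).
Proof. by case: hFA. Qed.

Lemma tau0l a : tau 0 a = tau 0 0.
Proof.
have := cocycle 0 0 a; rewrite !add0r => h.
by apply: (mulIf (tau_neq0 0 a)); rewrite h.
Qed.

Lemma tau0r a : tau a 0 = tau 0 0.
Proof.
have := cocycle a 0 0; rewrite !addr0 => h.
exact: (mulIf (tau_neq0 a 0)).
Qed.

(** The cocycle is not normalised, so [bar 0] is a nonzero scalar rather than 1: it multiplies every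
    [bar a] by [tau 0 a], which does not depend on a. *)
Lemma bar0 : bar 0 = (tau 0 0)%:A.
Proof.
suff h x : bar 0 * x = tau 0 0 *: x by rewrite -[LHS]mulr1 h.
rewrite (supp_sum bb x) scaler_sumr mulr_sumr; apply: eq_bigr => a _.
by rewrite -scalerAr barM add0r tau0l !scalerA mulrC.
Qed.

Lemma sum_delta (s : seq A) (f : A -> F) b : uniq s -> (b \notin s -> f b = 0) ->
  \sum_(c <- s) f c *+ (b == c) = f b.
Proof.
move=> us hf; have [bs|bs] := boolP (b \in s); last first.
  by rewrite (hf bs) big1 // => c _; case: eqP => // <-; exact: hf.
rewrite (bigD1_seq b) //= eqxx big1 ?addr0 // => c.
by rewrite eq_sym => /negPf ->.
Qed.

Lemma bcoefM_bar x a b : bcoef bar (x * bar a) (b + a) = bcoef bar x b * tau b a.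
Proof.
rewrite {1}(supp_sum bb x) mulr_suml bcoef_sum //.
under eq_bigr => c _ do
  rewrite -scalerAl barM scalerA bcoefZbar // (inj_eq (addIr a)).
rewrite (@sum_delta _ (fun c => bcoef bar x c * tau c a)) //; first exact: supp_uniq.
by rewrite mem_supp // negbK => /eqP ->; rewrite mul0r.
Qed.

Lemma bcoef_barM x a b : bcoef bar (bar a * x) (a + b) = tau a b * bcoef bar x b.
Proof.
rewrite {1}(supp_sum bb x) mulr_sumr bcoef_sum //.
under eq_bigr => c _ do
  rewrite -scalerAr barM scalerA bcoefZbar // (inj_eq (addrI a)).
rewrite (@sum_delta _ (fun c => bcoef bar x c * tau a c)) 1?mulrC //.
  exact: supp_uniq.
by rewrite mem_supp // negbK => /eqP ->; rewrite mulr0.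
Qed.

Lemma mul_expand x y : x * y = \sum_(a <- supp bar x) \sum_(b <- supp bar y)
  (bcoef bar x a * bcoef bar y b * tau a b) *: bar (a + b).
Proof.
rewrite {1}(supp_sum bb x) mulr_suml; apply: eq_bigr => a _.
rewrite {1}(supp_sum bb y) mulr_sumr; apply: eq_bigr => b _.
by rewrite -scalerAl -scalerAr barM !scalerA.
Qed.

(** Arbitrary sets are allowed because this is applied to boxes as well as to subgroups. *)
Lemma subalgM_add (B B' C : set A) x y :
  (forall a b, B a -> B' b -> C (a + b)) ->
  subalg bar B x -> subalg bar B' y -> subalg bar C (x * y).
Proof.
move=> hBC /(subalgP bb) hx /(subalgP bb) hy; rewrite mul_expand big_seq.
apply: subalg_sum => // a; rewrite mem_supp // => /hx Ba; rewrite big_seq.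
apply: subalg_sum => // b; rewrite mem_supp // => /hy Bb.
by apply: subalgZ => //; apply: subalg_bar => //; exact: hBC.
Qed.

Lemma subalgM (B : set A) x y : is_subgroup B ->
  subalg bar B x -> subalg bar B y -> subalg bar B (x * y).
Proof. by move=> hB; apply: subalgM_add => a b; exact: subgroupD. Qed.

Lemma subalg1 (B : set A) : B 0 -> subalg bar B 1.
Proof.
move=> B0; rewrite -[1](scalerK (tau_neq0 0 0)) -bar0.
by apply: subalgZ => //; exact: subalg_bar.
Qed.

(** The factor [tau 0 0] compensates for [bar 0] not being 1. *)
Definition bar_inv a : FA := (tau a (- a) * tau 0 0)^-1 *: bar (- a).

Lemma mulr_bar_inv a : bar a * bar_inv a = 1.
Proof.
rewrite /bar_inv -scalerAr barM subrr bar0 !scalerA -mulrA mulVf ?scale1r //.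
by rewrite mulf_neq0 ?tau_neq0.
Qed.

Definition bar_conj a x : FA := bar_inv a * x * bar a.

Lemma mul_bar_conj a x : bar a * bar_conj a x = x * bar a.
Proof. by rewrite /bar_conj !mulrA mulr_bar_inv mul1r. Qed.

(** As A is abelian, conjugation by [bar a] is diagonal in the basis, with nonzero eigenvalues;
    hence it preserves supports and every [subalg bar B]. *)
Lemma bcoef_conj a x b : bcoef bar (bar_conj a x) b = tau b a / tau a b * bcoef bar x b.
Proof.
apply: (mulfI (tau_neq0 a b)); rewrite -bcoef_barM mul_bar_conj addrC bcoefM_bar.
by rewrite mulrA [tau a b * _]mulrCA mulfV ?tau_neq0 // mulr1 mulrC.
Qed.

Lemma bcoef_conj_eq0 a x b : (bcoef bar (bar_conj a x) b == 0) = (bcoef bar x b == 0).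
Proof. by rewrite bcoef_conj !mulf_eq0 invr_eq0 !(negPf (tau_neq0 _ _)). Qed.

Lemma subalg_conj (B : set A) a x : subalg bar B x -> subalg bar B (bar_conj a x).
Proof.
by move=> /(subalgP bb) h; apply/(subalgP bb) => b; rewrite bcoef_conj_eq0 => /h.
Qed.

Lemma bar_conj_eq0 a x : bar_conj a x = 0 -> x = 0.
Proof.
by move=> h; rewrite -[x]mulr1 -(mulr_bar_inv a) mulrA -mul_bar_conj h mulr0 mul0r.
Qed.

Lemma centralP x : (forall a, x * bar a = bar a * x) -> alg_center FA x.
Proof.
move=> h y /=; rewrite (supp_sum bb y) mulr_suml mulr_sumr; apply: eq_bigr => a _.
by rewrite -scalerAl -scalerAr h.
Qed.

(* For an element [x] of minimal support containing 0, the difference between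
   [x] and a conjugate of [x] has smaller support, so [x] is central. *)
Lemma invariant_ideal_unit (B : set A) (J : set FA) :
  alg_center FA = scalars FA -> is_subgroup B -> J `<=` subalg bar B ->
  (forall x y, J x -> J y -> J (x - y)) ->
  (forall l x, J x -> J (l *: x)) ->
  (forall x b, J x -> B b -> J (x * bar b)) ->
  (forall a x, J x -> J (bar_conj a x)) ->
  forall x, J x -> x <> 0 -> J 1.
Proof.
move=> hcenter hB JB JD JZ JM Jc x.
have [n] := ubnP (size (supp bar x)); elim: n x => // n IH x ltn Jx x0.
have [a xa] := bcoef_neq0 bb x0.
pose y := x * bar (- a).
have Jy : J y.
  by apply: JM => //; apply: subgroupN => //; move/(subalgP bb): (JB _ Jx); exact.
have cy b : bcoef bar y (b - a) = bcoef bar x b * tau b (- a) by rewrite bcoefM_bar.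
have y0 : bcoef bar y 0 != 0 by rewrite -(subrr a) cy mulf_neq0 // tau_neq0.
have sy : (size (supp bar y) <= size (supp bar x))%N.
  rewrite -(size_map (fun b => b - a) (supp bar x)); apply: uniq_leq_size; first exact: supp_uniq.
  move=> b; rewrite mem_supp // => yb; apply/mapP; exists (b + a); last by rewrite addrK.
  by rewrite mem_supp //; move: yb; rewrite -{1}(addrK a b) cy mulf_eq0 negb_or => /andP[].
(* If y is central, it is a scalar, and a nonzero one because its coefficient at 0 is nonzero. *)
have [hc|] := pselect (forall b, y * bar b = bar b * y).
  have : scalars FA y by rewrite -hcenter; exact: centralP.
  move=> [l _ yE]; have l0 : l != 0.
    by apply: contraNneq y0 => l0; rewrite -yE l0 scale0r bcoef0.
  by rewrite -[1](scalerK l0) yE; exact: JZ.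
move=> /existsNP [b hb]; apply: (IH (bar_conj b y - y)).
- apply: (leq_trans _ (leq_trans sy ltn)).
  (* Conjugation fixes the coefficient at 0, so 0 leaves the support of the difference; putting it
     back in front gives the strict inequality. *)
  apply: (@uniq_leq_size _ (0 :: supp bar (bar_conj b y - y))).
    rewrite /= supp_uniq // andbT mem_supp // negbK bcoefB // bcoef_conj.
    by rewrite tau0l tau0r mulfV ?mul1r ?subrr // tau_neq0.
  move=> c; rewrite inE => /predU1P[->|]; rewrite !mem_supp //.
  by apply: contraNN => /eqP yc; rewrite bcoefB // bcoef_conj yc mulr0 subrr.
- by apply: JD => //; exact: Jc.
- by move=> /eqP; rewrite subr_eq0 => /eqP h; apply: hb; rewrite -mul_bar_conj h.
Qed.

End Twisted.

(** * Subgroups of free abelian groups *)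

Section FreeAbelian.
Variable A : zmodType.

Definition zcomb r (c : 'I_r -> A) (z : 'I_r -> int) : A := \sum_i c i *~ z i.

Definition zindep r (c : 'I_r -> A) : Prop :=
  forall z, zcomb c z = 0 -> forall i, z i = 0.

Lemma zindepP r (c : 'I_r -> zmodule A) : lin_indep setT c <-> zindep c.
Proof.
rewrite lin_indepP //; split=> h z; first by move=> hz; exact: h.
by move=> _; exact: h.
Qed.

Lemma zcombB r (c : 'I_r -> A) y z :
  zcomb c y - zcomb c z = zcomb c (fun i => y i - z i).
Proof. by rewrite /zcomb -sumrB; apply: eq_bigr => i _; rewrite mulrzBr. Qed.

Lemma zcombD r (c : 'I_r -> A) y z :
  zcomb c y + zcomb c z = zcomb c (fun i => y i + z i).
Proof. by rewrite /zcomb -big_split; apply: eq_bigr => i _; rewrite mulrzDr. Qed.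

Lemma zindep_inj r (c : 'I_r -> A) y z : zindep c -> zcomb c y = zcomb c z -> y = z.
Proof.
move=> hc /eqP; rewrite -subr_eq0 zcombB => /eqP /hc h; apply/funext => i.
by apply/eqP; rewrite -subr_eq0 h.
Qed.

Lemma ex_additive (V : zmodType) (f : A -> V) :
  {morph f : x y / x - y} -> exists g : {additive A -> V}, g =1 f.
Proof.
move=> hf; pose m := GRing.isZmodMorphism.Build _ _ f hf.
by exists (HB.pack_for {additive A -> V} f m).
Qed.

Lemma free_coords : fg_free_abelian A ->
  exists n (e : 'I_n -> A) (zc : 'I_n -> {additive A -> int}),
    forall a, a = zcomb e (zc^~ a).
Proof.
move=> [n [e [/zindepP ie se]]].
have ex a : exists z, a = zcomb e z.
  have : lin_span setT (range e) a by rewrite se.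
  by move=> /(lin_span_fspan _ _ (@subset_refl _ _)) [] // z [_ ->]; exists z.
have [zc hz] := choice ex.
have zcB a b : zc (a - b) = (fun i => zc a i - zc b i).
  by apply: (zindep_inj ie); rewrite -zcombB -!hz.
have ex_g i : exists g : {additive A -> int}, forall a, g a = zc a i.
  by apply: (@ex_additive int (zc^~ i)) => a b; rewrite zcB.
have [g gE] := choice ex_g.
exists n, e, g => a; rewrite [LHS]hz.
by apply: eq_bigr => i _; rewrite gE.
Qed.

Lemma coords_inj n (e : 'I_n -> A) (zc : 'I_n -> {additive A -> int}) :
  (forall a, a = zcomb e (zc^~ a)) -> forall a, (forall i, zc i a = 0) -> a = 0.
Proof.
by move=> h a a0; rewrite (h a) /zcomb big1 // => i _; rewrite a0.
Qed.

(** The product q has fewer than [size q] roots, so one of the integers 0, ..., [size q] - 1 is a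
    root of no factor. *)
Lemma ex_pos_poly_eval (s : seq {poly int}) : (forall p, p \in s -> p != 0) ->
  exists k : int, forall p, p \in s -> p.[k] != 0.
Proof.
move=> hs; pose q := \prod_(p <- s) p.
have q0 : q != 0 by rewrite prodf_seq_neq0; apply/allP => p /hs.
have /allPn [_ /mapP [k _ ->] kq] : ~~ all (root q) (map Posz (iota 0 (size q))).
  apply/negP => /(max_poly_roots q0); rewrite map_inj_uniq ?iota_uniq; last by move=> ? ? [].
  by move=> /(_ isT); rewrite size_map size_iota ltnn.
exists k%:Z => p ps; apply: contraNneq kq => pk.
by rewrite /root horner_prod prodf_seq_eq0; apply/hasP; exists p => //; rewrite pk eqxx.
Qed.

(** The coordinates of a are read as the coefficients of a polynomial, which is evaluated at an
    integer that is a root of none of the finitely many nonzero differences. *)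
Lemma ex_separating_form (s : seq A) : fg_free_abelian A ->
  exists phi : A -> int, {morph phi : a b / a + b} /\ {in s &, injective phi}.
Proof.
move=> /free_coords [n [e [zc /coords_inj zc0]]].
pose P a := rVpoly (\row_i zc i a).
have PB a b : P (a - b) = P a - P b.
  by rewrite /P -raddfB; congr rVpoly; apply/rowP => i; rewrite !mxE raddfB.
have PD a b : P (a + b) = P a + P b.
  by rewrite /P -raddfD; congr rVpoly; apply/rowP => i; rewrite !mxE raddfD.
pose s2 := [seq p <- [seq P (a - b) | a <- s, b <- s] | p != 0].
have [|k hk] := @ex_pos_poly_eval s2; first by move=> p; rewrite mem_filter => /andP[].
exists (fun a => (P a).[k]); split=> [a b|a b sa sb /eqP].
  by rewrite PD hornerD.
rewrite -subr_eq0 -hornerN -hornerD -PB.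
apply: contraTeq => ab; apply: hk; rewrite mem_filter; apply/andP; split; last first.
  by apply/allpairsP; exists (a, b).
apply: contraNneq ab => h; rewrite -subr_eq0; apply/eqP/zc0 => i.
have := rVpolyK (\row_i zc i (a - b)); rewrite -[rVpoly _]/(P _) h raddf0.
by move=> /rowP /(_ i); rewrite !mxE.
Qed.

Lemma ex_max_seq (s : seq A) (phi : A -> int) : s != [::] ->
  exists2 a, a \in s & forall b, b \in s -> phi b <= phi a.
Proof.
elim: s => // a [|b s] IH _; first by exists a => [|c]; rewrite inE // => /eqP ->.
have [//|c cs hc] := IH; have [ac|/ltW ca] := lerP (phi a) (phi c).
  by exists c => [|d]; rewrite inE ?cs ?orbT // => /predU1P[-> //|/hc].
exists a => [|d]; rewrite ?mem_head // inE => /predU1P[-> //|/hc] h.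
exact: le_trans ca.
Qed.

(** Filter B by the subgroups [Bd d] on which the coordinates of index at least d vanish. Going from
    d to d + 1, either nothing new appears or one basis element b does, whose d-th coordinate
    generates all values taken there. *)
Lemma subgroup_basis (B : set A) : fg_free_abelian A -> is_subgroup B ->
  exists r (c : 'I_r -> A), zindep c /\ forall a, B a <-> exists z, a = zcomb c z.
Proof.
move=> /free_coords [n [e [zc /coords_inj zc0]]] hB.
pose Bd d := [set a | B a /\ forall i : 'I_n, (d <= i)%N -> zc i a = 0].
suff [r [c [ic hc]]] : exists r (c : 'I_r -> A),
    zindep c /\ forall a, Bd n a <-> exists z, a = zcomb c z.
  exists r, c; split=> // a; rewrite -hc; split=> [Ba|[]] //; split=> // i.
  by rewrite leqNgt ltn_ord.
have: (n <= n)%N by [].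
elim: {1 3}n => [_|d IH ltdn].
  exists 0%N, (fun=> 0); split=> [z _ []//|a]; split=> [[_ h]|[z ->]].
    by exists (fun=> 0); rewrite /zcomb big_ord0; apply: zc0 => i; exact: h.
  rewrite /zcomb big_ord0; split; first exact: hB.1.
  by move=> i _; rewrite raddf0.
have [r [c [ic hc]]] := IH (ltnW ltdn).
set f := zc (Ordinal ltdn).
have BdB k a b : Bd k a -> Bd k b -> Bd k (a - b).
  move=> [Ba ha] [Bb hb]; split; first exact: hB.2.
  by move=> i ki; rewrite raddfB ha // hb // subrr.
have BdM k a z : Bd k a -> Bd k (a *~ z).
  move=> [Ba ha]; split; first exact: subgroupMz.
  by move=> i ki; rewrite raddfMz ha // mul0rz.
have Bd0 a : Bd d.+1 a -> f a = 0 -> Bd d a.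
  move=> [Ba ha] fa; split=> // i; rewrite leq_eqVlt => /predU1P[di|]; last exact: ha.
  by rewrite -fa; congr (zc _ a); apply: val_inj.
have BdS a : Bd d a -> Bd d.+1 a.
  by move=> [Ba ha]; split=> // i /ltnW; exact: ha.
have fBd a : Bd d a -> f a = 0 by case=> _; apply.
have [h0|/existsNP [a1 /not_implyP [Ba1 fa1]]] := pselect (forall a, Bd d.+1 a -> f a = 0).
  exists r, c; split=> // a; rewrite -hc; split=> [Ba|]; last exact: BdS.
  by apply: Bd0 => //; exact: h0.
(* The generator g is the least positive value of the coordinate [f] on [Bd d.+1], attained at b. *)
have exk : exists k, `[< (0 < k)%N /\ exists2 a, Bd d.+1 a & f a = k%:Z >].
  exists `|f a1|%N; apply/asboolP; split; first by rewrite absz_gt0; apply/eqP.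
  have [fp|fn] := leP 0 (f a1); first by exists a1 => //; rewrite gez0_abs.
  by exists (a1 *~ -1); [exact: BdM|rewrite raddfMz mulrN1z ltz0_abs].
case: (ex_minnP exk) => g /asboolP [g0 [b Bb fb]] ming.
have gz0 : g%:Z != 0 by rewrite eqz_nat -lt0n.
(* Euclidean division by g: a nonzero remainder would be a smaller positive value of [f]. *)
have divg a : Bd d.+1 a -> exists z, Bd d (a - b *~ z).
  move=> Ba; set z := (f a %/ g)%Z; exists z.
  set w := a - b *~ z; have Bw : Bd d.+1 w by apply: BdB => //; exact: BdM.
  apply: Bd0 => //; have fE : f w = (f a %% g)%Z.
    by rewrite raddfB raddfMz fb mulrzz mulrC.
  apply/eqP/negPn/negP => fn0; have fge : 0 <= f w by rewrite fE modz_ge0.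
  have /ming : `[< (0 < `|f w|)%N /\ exists2 a', Bd d.+1 a' & f a' = `|f w|%N >].
    by apply/asboolP; rewrite absz_gt0; split=> //; exists w => //; rewrite gez0_abs.
  by rewrite leqNgt -ltz_nat gez0_abs // fE ltz_pmod.
exists r.+1, (fun i => if unlift ord0 i is Some i' then c i' else b).
have zE z : zcomb (fun i => if unlift ord0 i is Some i' then c i' else b) z =
    b *~ z ord0 + zcomb c (fun i => z (lift ord0 i)).
  rewrite /zcomb big_ord_recl unlift_none; congr (_ + _).
  by apply: eq_bigr => i _; rewrite liftK.
split=> [z|a]; rewrite ?zE.
  move=> h0; have Bc : Bd d (zcomb c (fun i => z (lift ord0 i))) by apply/hc; eexists.
  have z0 : z ord0 = 0.
    have := congr1 f h0; rewrite raddfD raddf0 raddfMz (fBd _ Bc) addr0 fb mulrzz.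
    by move/eqP; rewrite mulf_eq0 (negPf gz0) => /eqP.
  move=> i; case: (unliftP ord0 i) => [j ->|-> //].
  by apply: (ic (fun i => z (lift ord0 i))); rewrite -[RHS]h0 z0 mulr0z add0r.
split=> [/divg [z /hc [y yE]]|[z ->]]; last first.
  rewrite zE -[zcomb _ _]opprK; apply: BdB; first exact: BdM.
  by rewrite -mulrN1z; apply: BdM; apply/BdS/hc; eexists.
exists (fun i => if unlift ord0 i is Some i' then y i' else z).
rewrite zE unlift_none; under [zcomb c _]eq_bigr do rewrite liftK.
by rewrite -/(zcomb c y) -yE addrC subrK.
Qed.

End FreeAbelian.

(** * Finite index, absence of zero divisors, commutation *)

Section FiniteIndex.
Variables (A : zmodType) (C C0 : set A).
Hypotheses (hC : is_subgroup C) (hC0 : is_subgroup C0).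
Hypotheses (hC0C : C0 `<=` C) (hfin : finite_index C C0).

Lemma finite_index_reps : exists q (u : 'I_q -> A),
  forall a, C a -> exists i, C0 (a - u i).
Proof.
have /finite_seqP [s sE] := hfin.
have hs (i : 'I_(size s)) : exists u, [set u + b | b in C0] = nth set0 s i.
  have : [set` s] (nth set0 s i) by rewrite /= mem_nth.
  by rewrite -sE => -[u Cu uE]; exists u.
have [u hu] := choice hs.
exists (size s), u => a Ca.
have : [set` s] [set a + b | b in C0] by rewrite -sE; exists a.
move=> /= /(nthP set0) [i lti iE].
have : [set u (Ordinal lti) + b | b in C0] a.
  by rewrite hu /= iE; exists 0; [exact: hC0.1|rewrite addr0].
by move=> [b C0b <-]; exists (Ordinal lti); rewrite addrC addKr.
Qed.

(** Pigeonhole: among the q + 1 multiples 0, a, ..., q a, two lie in the same one of q cosets. *)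
Lemma finite_index_mult a : C a -> exists n, (0 < n)%N /\ C0 (a *+ n).
Proof.
move=> Ca; have [q [u hu]] := finite_index_reps.
have [t ht] := choice (fun k : 'I_q.+1 => hu _ (subgroupMn hC k Ca)).
have /injectivePn [j [k jk tjk]] : ~~ injectiveb t.
  by apply/negP => /injectiveP /leq_card; rewrite !card_ord ltnn.
wlog ltjk : j k jk tjk / (j < k)%N.
  move=> h; case: (ltngtP j k) => [|kj|/val_inj jkE]; first exact: h.
    by apply: (h k j) => //; rewrite eq_sym.
  by rewrite jkE eqxx in jk.
exists (k - j)%N; split; first by rewrite subn_gt0.
rewrite mulrnBr ?(ltnW ltjk) //.
have := hC0.2 _ _ (ht k) (ht j).
by rewrite tjk opprB addrA subrK.
Qed.

(** The basis of C0 gives the lower bound. Conversely, more than r elements of C have positive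
    multiples in C0, and an integral relation between these multiples is one between the elements
    themselves. *)
Lemma rk_finite_index (R : realType) r (c : 'I_r -> A) : zindep c ->
  (forall a, C0 a <-> exists z, a = zcomb c z) -> rk R C = (r%:R)%:E.
Proof.
move=> ic hc; apply/eqP; rewrite eq_le; apply/andP; split; last first.
  apply: (@vdim_ge _ _ (zmodule A) _ _ _ c); last exact/zindepP.
  move=> i; apply/hC0C/hc; exists (fun j => (j == i)%:Z).
  by rewrite /zcomb (bigD1 i) //= eqxx big1 ?addr0 // => j /negPf ->.
apply: ge_ereal_sup => _ /= [k [v [Cv /zindepP iv ->]]].
rewrite lee_fin ler_nat leqNgt; apply/negP => ltk.
have hint : comm_subdomain [set: int].
  split=> // x y _ _; first exact: mulrC.
  by move/eqP; rewrite mulf_eq0 => /orP[] /eqP; [left|right].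
have [N hN] := choice (fun i => finite_index_mult (Cv i)).
have hv i : fspan setT (c : 'I_r -> zmodule A) (v i *+ N i).
  by have /hc [z ->] := (hN i).2; exists z.
have [|x [_ [i xi] hx]] := fspan_dep hint _ hv; first by rewrite card_ord.
have /iv /(_ i) /eqP : zcomb v (fun i => x i * (N i)%:Z) = 0.
  rewrite -[RHS]hx; apply: eq_bigr => j _.
  by rewrite mulrC [LHS]mulrzA.
by rewrite mulf_eq0 => /orP[/eqP //|]; rewrite eqz_nat gtn_eqF // (hN i).1.
Qed.

End FiniteIndex.

Section Domain.
Variables (F : fieldType) (A : zmodType) (FA : algType F).
Variables (bar : A -> FA) (tau : A -> A -> F).
Hypothesis hFA : twisted_group_algebra bar tau.
Hypothesis hA : fg_free_abelian A.

Let bb : is_basis bar. Proof. by case: hFA. Qed.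

(* An additive form which is injective on both supports orders them; the
   product of the leading terms cannot cancel. *)
Lemma tga_domain (x y : FA) : x * y = 0 -> x = 0 \/ y = 0.
Proof.
move=> xy0; apply: contrapT => /not_orP [x0 y0].
have [phi [phiD phi_inj]] := ex_separating_form (supp bar x ++ supp bar y) hA.
have max z : z <> 0 -> exists2 a, bcoef bar z a != 0 &
    forall b, bcoef bar z b != 0 -> phi b <= phi a.
  move=> /(bcoef_neq0 bb) [c zc]; have [|a az ha] := @ex_max_seq _ (supp bar z) phi.
    by apply: contraTneq zc => s0; rewrite -mem_supp // s0.
  by exists a => [|b]; rewrite -mem_supp //; exact: ha.
have [a xa ha] := max x x0; have [b yb hb] := max y y0.
have key c d : bcoef bar x c != 0 -> bcoef bar y d != 0 -> a + b = c + d -> c = a /\ d = b.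
  move=> xc yd abcd; suff ca : c = a by split=> //; move: abcd; rewrite ca => /addrI.
  apply: phi_inj; rewrite ?mem_cat ?mem_supp ?xc ?xa //.
  have := congr1 phi abcd; rewrite !phiD => e.
  apply/eqP; rewrite eq_le ha //= -(lerD2r (phi b)) e lerD2l; exact: hb.
have : bcoef bar (x * y) (a + b) = bcoef bar x a * bcoef bar y b * tau a b.
  rewrite (mul_expand hFA) bcoef_sum // (bigD1_seq a) ?mem_supp ?supp_uniq //=.
  rewrite bcoef_sum // (bigD1_seq b) ?mem_supp ?supp_uniq //= bcoefZbar // eqxx.
  rewrite !big1_seq ?addr0 //.
    move=> c /andP[ca]; rewrite mem_supp // => xc; rewrite bcoef_sum // big1_seq // => d.
    rewrite mem_supp // bcoefZbar // => yd.
    by case: eqP => // /(key _ _ xc yd) [caE _]; rewrite caE eqxx in ca.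
  move=> d /andP[db]; rewrite mem_supp // bcoefZbar // => yd.
  by case: eqP => // /(key _ _ xa yd) [_ dbE]; rewrite dbE eqxx in db.
rewrite xy0 bcoef0 // => /esym/eqP.
by rewrite !mulf_eq0 (negPf xa) (negPf yb) (negPf (tau_neq0 hFA _ _)).
Qed.

Lemma tga_comm_subdomain (B : set A) : is_subgroup B ->
  (forall x y : FA, subalg bar B x -> subalg bar B y -> x * y = y * x) ->
  comm_subdomain (subalg bar B : set FA^c).
Proof.
move=> hB hcomm; split.
- exact: (subalg1 hFA hB.1).
- by move=> x y; exact: subalgB.
- by move=> x y Bx By; exact: (subalgM hFA hB).
- by move=> x y Bx By; apply: hcomm.
- by move=> x y _ _ /tga_domain [] ->; [right|left].
Qed.

Lemma scalars_comm_subdomain : comm_subdomain (scalars FA : set FA^c).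
Proof.
split.
- by exists 1 => //; rewrite scale1r.
- by move=> _ _ [k _ <-] [l _ <-]; exists (k - l) => //; rewrite scalerBl.
- move=> _ _ [k _ <-] [l _ <-]; exists (k * l) => //.
  by rewrite -[RHS]/((l%:A : FA) * k%:A) -scalerAl mul1r scalerA mulrC.
- move=> _ _ [k _ <-] [l _ <-]; rewrite -[LHS]/((l%:A : FA) * k%:A) -[RHS]/((k%:A : FA) * l%:A).
  by rewrite -!scalerAl !mul1r !scalerA mulrC.
- by move=> x y _ _ /tga_domain [] ->; [right|left].
Qed.

(** The commutation bicharacter, for which [bar b * bar a = comm_char a b *: (bar a * bar b)]; its
    values on a basis of A are the parameters of the quantum torus. *)
Definition comm_char a b : F := tau b a / tau a b.

Lemma comm_charP a b : bar b * bar a = bar a * bar b <-> comm_char a b = 1.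
Proof.
rewrite !(barM hFA) [b + a]addrC /comm_char; split=> [h|h].
  have := congr1 (fun x => bcoef bar x (a + b)) h; rewrite !bcoefZbar // eqxx !mulr1n => ->.
  by rewrite divff // (tau_neq0 hFA).
by rewrite -[tau b a](divfK (tau_neq0 hFA a b)) h mul1r.
Qed.

Lemma comm_charV a b : comm_char b a = (comm_char a b)^-1.
Proof. by rewrite /comm_char invf_div. Qed.

Lemma bar_conj_bar a b : bar_conj bar tau a (bar b) = comm_char a b *: bar b.
Proof.
apply: (bcoef_inj bb) => c; rewrite (bcoef_conj hFA) bcoef_bar // bcoefZbar //.
by case: (c =P b) => [->|]; rewrite ?mulr1 ?mulr0.
Qed.

(** Conjugation by [bar a] is multiplicative and scales [bar b] by [comm_char a b]; this spares a
    computation with the cocycle. *)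
Lemma comm_charD a b c : comm_char a (b + c) = comm_char a b * comm_char a c.
Proof.
have : bar_conj bar tau a (bar b * bar c) =
    bar_conj bar tau a (bar b) * bar_conj bar tau a (bar c).
  rewrite /bar_conj -!mulrA; congr (_ * (_ * _)).
  by rewrite 2!mulrA (mulr_bar_inv hFA) mul1r.
rewrite !bar_conj_bar -scalerAl -scalerAr (barM hFA) /bar_conj.
rewrite -scalerAr -scalerAl -/(bar_conj bar tau a (bar (b + c))) bar_conj_bar.
move/(congr1 (fun x => bcoef bar x (b + c))).
rewrite !scalerA !bcoefZbar // eqxx !mulr1n mulrC => /(mulIf (tau_neq0 hFA _ _)).
by [].
Qed.

Lemma comm_charMn a b n : comm_char a (b *+ n) = comm_char a b ^+ n.
Proof.
elim: n => [|n IH]; last by rewrite mulrS comm_charD IH exprS.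
by rewrite /comm_char (tau0l hFA) (tau0r hFA) divff // (tau_neq0 hFA).
Qed.

Lemma central_bar a : alg_center FA = scalars FA ->
  (forall b, comm_char a b = 1) -> a = 0.
Proof.
move=> hcenter h; have : scalars FA (bar a).
  by rewrite -hcenter; apply: (centralP hFA) => b; apply/esym/comm_charP.
move=> [l _ lE]; apply: contrapT => /eqP a0.
(* A scalar is a multiple of [bar 0], hence has coefficient 0 at a. *)
have : bcoef bar (tau 0 0 *: bar a) a = 0.
  by rewrite -lE scalerA mulrC -scalerA -(bar0 hFA) bcoefZbar // (negPf a0).
by move/eqP; rewrite bcoefZbar // eqxx mulr1n (negPf (tau_neq0 hFA _ _)).
Qed.

Lemma free_mulrn_eq0 (a : A) n : (0 < n)%N -> a *+ n = 0 -> a = 0.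
Proof.
move=> n0 an; have [m [e [zc /coords_inj zc0]]] := free_coords hA.
apply: zc0 => i; have := congr1 (zc i) an; rewrite raddfMn raddf0 => /eqP.
by rewrite mulrn_eq0 -leqn0 leqNgt n0 => /eqP.
Qed.

(* If every element had a multiple in [B], then [A *+ N] would lie in [B] for a
   single [N], and [A *+ N ^ 2] would be central. *)
Lemma ex_infinite_order (B : set A) : alg_center FA = scalars FA -> is_subgroup B ->
  (forall x y : FA, subalg bar B x -> subalg bar B y -> x * y = y * x) ->
  (exists a : A, a <> 0) ->
  exists a, forall n, (0 < n)%N -> ~ B (a *+ n).
Proof.
move=> hcenter hB hcomm [a0 a0N]; apply: contrapT => /forallNP h.
have {}h a : exists n, (0 < n)%N /\ B (a *+ n).
  apply: contrapT => /forallNP h'; apply: (h a) => n n0 Ban.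
  by apply: (h' n).
have [m [e [zc he]]] := free_coords hA.
have [N hN] := choice (fun i => h (e i)).
pose M := (\prod_i N i)%N.
have M0 : (0 < M)%N by rewrite prodn_gt0 // => i; have [] := hN i.
have BM a : B (a *+ M).
  rewrite (he a) /zcomb -sumrMnl; apply: subgroup_sum => // i _.
  by rewrite pmulrn mulrzAC; apply: subgroupMz => //; rewrite /M (bigD1 i) //= -pmulrn mulrnA;
    apply: subgroupMn => //; have [] := hN i.
(* One factor M moves from a0 to b in the bicharacter; then both arguments lie in B, whose basis
   elements commute. *)
have a0M : a0 *+ (M * M) = 0.
  apply: central_bar => // b; rewrite mulrnA comm_charV comm_charMn -comm_charMn.
  suff -> : comm_char b (a0 *+ M *+ M) = 1 by rewrite invr1.
  rewrite comm_charMn comm_charV exprVn -comm_charMn.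
  suff -> : comm_char (a0 *+ M) (b *+ M) = 1 by rewrite invr1.
  by apply/comm_charP/hcomm; exact: subalg_bar.
by apply: a0N; apply: (free_mulrn_eq0 _ a0M); rewrite muln_gt0 M0.
Qed.

End Domain.

(** * Purity of submodules and finite length *)

Section Torsion.
Variables (K : nzRingType) (S : set K) (V : lmodType K).
Hypothesis hS : comm_subdomain S.

(** Stability under S alone: the induction in [torsion_killed] enlarges N by S-multiples of a
    generator, which need not give a K-submodule. *)
Definition sub_closed (N : set V) : Prop :=
  [/\ N 0, (forall x y, N x -> N y -> N (x + y)) & (forall a x, S a -> N x -> N (a *: x))].

Lemma submodule_closed N : is_submodule N -> sub_closed N.
Proof. by case=> N0 ND NZ; split=> // a x _; exact: NZ. Qed.

(** The preimage in V of the S-torsion of V / N, without forming the quotient. *)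
Definition torsion_mod (N : set V) : set V :=
  [set t | exists x, [/\ S x, x <> 0 & N (x *: t)]].

Lemma sub_closedN N x : sub_closed N -> N x -> N (- x).
Proof.
move=> [_ _ NZ] Nx; rewrite -scaleN1r; apply: NZ => //.
by apply: (subdomN hS); exact: subdom1.
Qed.

Lemma sub_closedB N x y : sub_closed N -> N x -> N y -> N (x - y).
Proof. by move=> hN Nx Ny; case: (hN) => _ ND _; apply: ND => //; exact: sub_closedN. Qed.

(** Induction on the number of generators of V modulo N: the first generator is absorbed into a
    larger N', and the element d' found for N' is then corrected. *)
Lemma torsion_killed k (m : 'I_k -> V) (N : set V) : sub_closed N ->
  (forall v, exists c : 'I_k -> K, (forall i, S (c i)) /\ N (v - \sum_i c i *: m i)) ->
  exists d, [/\ S d, d <> 0 & forall t, torsion_mod N t -> N (d *: t)].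
Proof.
elim: k m N => [|k IH] m N hN hm.
  exists 1; split; [exact: subdom1 hS|by apply/eqP; rewrite oner_neq0|].
  by move=> t _; have [c []] := hm t; rewrite big_ord0 subr0 scale1r.
have [N0 ND NZ] := hN.
pose N' := [set v | exists c, S c /\ N (v - c *: m ord0)].
have NN' : N `<=` N'.
  by move=> v Nv; exists 0; split; [exact: subdom0 hS|rewrite scale0r subr0].
have [||d' [Sd' d'0 hd']] := IH (fun i => m (lift ord0 i)) N'.
- split; first exact: NN'.
    move=> x y [c [Sc Nc]] [d [Sd Nd]]; exists (c + d); split; first exact: subdomD.
    by rewrite scalerDl opprD addrACA; exact: ND.
  move=> a x Sa [c [Sc Nc]]; exists (a * c); split; first exact: subdomM.
  by rewrite -scalerA -scalerBr; exact: NZ.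
- move=> v; have [c [Sc Nc]] := hm v; exists (fun i => c (lift ord0 i)); split=> //.
  exists (c ord0); split=> //; move: Nc; rewrite big_ord_recl opprD addrCA.
  by rewrite addrC.
(* If x sends the first generator into N, then [x * d'] works: d' moves t into N', and x takes the
   remaining multiple of the generator into N. *)
have [[x [Sx x0 Nx]]|nt] := pselect (exists x, [/\ S x, x <> 0 & N (x *: m ord0)]).
  exists (x * d'); split; first exact: subdomM.
    by move/(subdom_eq0 hS Sx Sd') => [].
  move=> t [y [Sy y0 Ny]]; have [|c [Sc Nc]] := hd' t; first by exists y; split=> //; exact: NN'.
  rewrite -scalerA -[d' *: t](subrK (c *: m ord0)) scalerDr; apply: ND; first exact: NZ.
  by rewrite scalerA (subdomC hS) // -scalerA; exact: NZ.
(* Otherwise the first generator is torsion-free modulo N, so y c = 0 in the relation below, whence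
   c = 0 and d' itself works. *)
exists d'; split=> // t [y [Sy y0 Ny]].
have [|c [Sc Nc]] := hd' t; first by exists y; split=> //; exact: NN'.
suff c0 : c = 0 by move: Nc; rewrite c0 scale0r subr0.
suff yc0 : y * c = 0 by case: (subdom_eq0 hS Sy Sc yc0).
apply: contrapT => yc0; apply: nt; exists (y * c); split=> //; first exact: subdomM.
rewrite -scalerA -[_ *: _](subKr (y *: (d' *: t))); apply: sub_closedB => //.
  by rewrite scalerA (subdomC hS) // -scalerA; exact: NZ.
by rewrite -scalerBr; exact: NZ.
Qed.

(** Pick one vector in each difference of the chain. In a nontrivial relation the vector of largest
    index j with nonzero coefficient is torsion modulo [N j], hence lies in [N j] by purity, a
    contradiction. *)
Lemma pure_chain_bound (T : finType) (m : T -> V) l (N : nat -> set V) :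
  fspan S m = setT ->
  (forall i, (i <= l)%N -> sub_closed (N i)) ->
  (forall i, (i <= l)%N -> torsion_mod (N i) `<=` N i) ->
  (forall i, (i < l)%N -> N i `<=` N i.+1 /\ N i <> N i.+1) ->
  (l <= #|T|)%N.
Proof.
move=> hm hN hp hs; rewrite leqNgt; apply/negP => ltl.
have mono j i : (j <= i)%N -> (i <= l)%N -> N j `<=` N i.
  elim: i => [|i IH]; first by rewrite leqn0 => /eqP -> _ x.
  rewrite leq_eqVlt => /orP[/eqP -> _ x //|ji il].
  by apply: subset_trans (hs _ il).1; apply: IH => //; exact: ltnW.
have ex_v (i : 'I_l) : exists v, N i.+1 v /\ ~ N i v.
  apply: contrapT => /forallNP h; have [sN nN] := hs i (ltn_ord i).
  by apply: nN; apply/seteqP; split=> // x Nx; apply: contrapT => nx; exact: (h x).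
have [v hv] := choice ex_v.
have [|x [Sx [i0 xi0] hx]] := @fspan_dep _ _ hS _ _ m _ v ltl; first by rewrite hm.
have xi0' : x i0 != 0 by apply/eqP.
case: (@arg_maxnP _ i0 (fun i => x i != 0) val xi0') => j xj hj.
have [Nj nNj] := hv j; apply: nNj; apply: (hp _ (ltnW (ltn_ord j))).
exists (x j); split; [exact: Sx|exact/eqP|].
have hNj := hN _ (ltnW (ltn_ord j)); have [N0 ND NZ] := hNj.
move: hx; rewrite (bigD1 j) //= => /eqP; rewrite addr_eq0 => /eqP ->.
apply: sub_closedN => //; elim/big_rec: _ => // i y ij Ny; apply: ND => //.
have [->|xi] := eqVneq (x i) 0; first by rewrite scale0r.
apply: NZ; first exact: Sx.
have ltij : (i < j)%N by rewrite ltn_neqAle; apply/andP; split=> //; exact: hj.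
by apply: (mono i.+1) => //; [exact: ltnW|exact: (hv i).1].
Qed.

End Torsion.

Section RightAction.
Variables (F : fieldType) (FA : algType F) (M : lmodType FA^c).
Implicit Types (t u : M) (x y : FA).

Lemma ractM t x y : ract t (x * y) = ract (ract t x) y.
Proof. by rewrite /ract scalerA. Qed.

Lemma ract1 t : ract t 1 = t. Proof. exact: scale1r. Qed.
Lemma ract0 t : ract t 0 = 0. Proof. exact: scale0r. Qed.
Lemma ract0l x : ract (0 : M) x = 0. Proof. exact: scaler0. Qed.
Lemma ractDl t u x : ract (t + u) x = ract t x + ract u x. Proof. exact: scalerDr. Qed.
Lemma ractDr t x y : ract t (x + y) = ract t x + ract t y. Proof. exact: scalerDl. Qed.
Lemma ractBr t x y : ract t (x - y) = ract t x - ract t y. Proof. exact: scalerBl. Qed.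
(** M has no separate F-module structure: scalars act through [l%:A]. *)
Lemma ractZr t l x : ract t (l *: x) = ract (ract t x) l%:A.
Proof. by rewrite -ractM -scalerAr mulr1. Qed.
Lemma ractZl t l x : ract (ract t l%:A) x = ract t (l *: x).
Proof. by rewrite -ractM -scalerAl mul1r. Qed.
Lemma ract_sumr (I : Type) (r : seq I) (P : pred I) (f : I -> FA) t :
  ract t (\sum_(i <- r | P i) f i) = \sum_(i <- r | P i) ract t (f i).
Proof. exact: scaler_suml. Qed.
Lemma ract_suml (I : Type) (r : seq I) (P : pred I) (f : I -> M) x :
  ract (\sum_(i <- r | P i) f i) x = \sum_(i <- r | P i) ract (f i) x.
Proof. exact: scaler_sumr. Qed.

Lemma submodule_ract (N : set M) t x : is_submodule N -> N t -> N (ract t x).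
Proof. by case=> _ _; exact. Qed.

End RightAction.

Section Modules.
Variables (F : fieldType) (A : zmodType) (FA : algType F).
Variables (bar : A -> FA) (tau : A -> A -> F) (M : lmodType FA^c) (B : set A).
Hypotheses (hFA : twisted_group_algebra bar tau) (hA : fg_free_abelian A).
Hypothesis hcenter : alg_center FA = scalars FA.
Hypothesis hB : is_subgroup B.
Hypothesis hcomm : forall x y : FA, subalg bar B x -> subalg bar B y -> x * y = y * x.
Variables (k : nat) (m : 'I_k -> M).
Hypothesis hm : fspan (subalg bar B : set FA^c) m = setT.

Let bb : is_basis bar. Proof. by case: hFA. Qed.
Let hK : comm_subdomain (subalg bar B : set FA^c).
Proof. exact: (tga_comm_subdomain hFA hA hB hcomm). Qed.

Lemma submodule_pure (N : set M) : is_submodule N ->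
  torsion_mod (subalg bar B : set FA^c) N `<=` N.
Proof.
move=> hN; have [N0 ND NZ] := hN.
have hNc := submodule_closed (subalg bar B : set FA^c) hN.
set T := torsion_mod _ _.
have [|d [Kd d0 hd]] := torsion_killed hK (m := m) hNc.
  move=> v; have : fspan (subalg bar B : set FA^c) m v by rewrite hm.
  by move=> [c [Kc ->]]; exists c; rewrite subrr.
(* If x moves t into N, then the conjugate of x by [bar a] moves t [bar a] into N. *)
have TM t a : T t -> T (ract t (bar a)).
  move=> [x [Kx x0 Nx]]; exists (bar_conj bar tau a x); split.
  - exact: (subalg_conj hFA).
  - by move/(bar_conj_eq0 hFA).
  - have -> : (bar_conj bar tau a x : FA^c) *: ract t (bar a) = ract (ract t x) (bar a).
      by rewrite -[LHS]/(ract (ract _ _) _) -!ractM (mul_bar_conj hFA).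
    exact: submodule_ract.
have TZ t l : T t -> T (ract t l%:A).
  move=> [x [Kx x0 Nx]]; exists x; split=> //.
  rewrite -[_ *: _]/(ract (ract t _) x) ractZl ractZr; exact: submodule_ract.
pose J := [set x : FA | subalg bar B x /\ forall t, T t -> N (ract t x)].
have [] : J 1.
  apply: (invariant_ideal_unit hFA (B := B) (J := J) hcenter hB _ _ _ _ _ (x := d)) => //.
  - by move=> x [].
  - move=> x y [Kx hx] [Ky hy]; split; first exact: subalgB.
    by move=> t Tt; rewrite ractBr; apply: (sub_closedB hK hNc); [exact: hx|exact: hy].
  - move=> l x [Kx hx]; split; first exact: subalgZ.
    by move=> t Tt; rewrite ractZr; apply: submodule_ract => //; exact: hx.
  - move=> x b [Kx hx] Bb; split; first by apply: (subalgM hFA) => //; exact: subalg_bar.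
    by move=> t Tt; rewrite ractM; apply: submodule_ract => //; exact: hx.
  - move=> a x [Kx hx]; split; first exact: (subalg_conj hFA).
    (* The factor [bar_inv a] acts first and keeps t inside T, to which the hypothesis on x
       applies. *)
    move=> t Tt; rewrite /bar_conj 2!ractM; apply: submodule_ract => //; apply: hx.
    by rewrite /bar_inv ractZr; apply/TZ/TM.
by move=> _ h t /h; rewrite ract1.
Qed.

Lemma torsion0_ksub (t : M) (x : FA) : subalg bar B x -> x <> 0 -> ract t x = 0 -> t = 0.
Proof.
move=> Kx x0 tx; have hN : is_submodule [set (0 : M)].
  by split=> //= [u v -> ->|a u ->]; rewrite ?addr0 ?scaler0.
by apply: (submodule_pure hN); exists x.
Qed.

Lemma submodule_chain_bound l (N : nat -> set M) :
  (forall i, (i <= l)%N -> is_submodule (N i)) ->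
  (forall i, (i < l)%N -> N i `<=` N i.+1 /\ N i <> N i.+1) -> (l <= k)%N.
Proof.
move=> hN hs; rewrite -[k]card_ord.
apply: (pure_chain_bound hK hm) hs => i /hN; first exact: submodule_closed.
exact: submodule_pure.
Qed.

(** A longest strict chain from 0 to M is a composition series. It exists because lengths are at
    most k and, M being nonzero, there is a chain of length 1. *)
Lemma finite_length_of_fg : (exists t : M, t != 0) -> finite_length M.
Proof.
move=> [t0 /eqP t00].
pose chain l (N : nat -> set M) := [/\ N 0%N = [set 0], N l = setT,
  (forall i, (i <= l)%N -> is_submodule (N i))
  & (forall i, (i < l)%N -> N i `<=` N i.+1 /\ N i <> N i.+1)].
have ex : exists l, `[< exists N, chain l N >].
  exists 1%N; apply/asboolP; exists (fun i => if i is 0%N then [set 0] else setT).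
  split=> // [[|i] _|[|//] _] /=.
  - by split=> //= [u v -> ->|a u ->]; rewrite ?addr0 ?scaler0.
  - by [].
  - by split=> // h; apply: t00; have : [set: M] t0 by []; rewrite -h.
have bnd l : `[< exists N, chain l N >] -> (l <= k)%N.
  by move=> /asboolP [N [_ _ hN hs]]; exact: (submodule_chain_bound hN hs).
have [l /asboolP [N [N0 Nl hN hs]] maxl] := ex_maxnP ex bnd.
exists l, N; split=> // i il; have [sN nN] := hs i il; split=> // P hP NP PN.
apply: contrapT => /not_orP [P1 P2].
suff /maxl : `[< exists N, chain l.+1 N >] by rewrite ltnn.
(* P is inserted at position i + 1 and the later terms move up by one. *)
apply/asboolP; exists (fun j => if (j <= i)%N then N j else if j == i.+1 then P else N j.-1).
split=> [//||j jl|j jl] /=.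
- by rewrite leqNgt ltnW //= eqSS gtn_eqF.
- case: ifP => [ji|]; first by apply: hN; exact: leq_trans (ltnW il).
  by case: ifP => // _ _; apply: hN; rewrite -ltnS; case: j jl.
case: (ltngtP j i) => [ji|ij|->] /=; last by rewrite eqxx; split=> // /esym.
  by apply: hs; exact: ltn_trans il.
rewrite eqSS [j == i]gtn_eqF //.
case: (j =P i.+1) => [->|/eqP ji] /=; first by split=> // /P2.
have : (i.+1 < j)%N by rewrite ltn_neqAle eq_sym ji.
by case: j jl ij ji => // j jl _ _ _ /=; exact: hs.
Qed.

End Modules.

(** * Torsion over F * C and cyclicity *)

Section Cosets.
Variables (F : fieldType) (A : zmodType) (FA : algType F).
Variables (bar : A -> FA) (tau : A -> A -> F) (B C : set A).
Hypotheses (hFA : twisted_group_algebra bar tau) (hA : fg_free_abelian A).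
Hypotheses (hB : is_subgroup B) (hC : is_subgroup C).
Hypothesis hcomm : forall x y : FA, subalg bar B x -> subalg bar B y -> x * y = y * x.
Variables (q : nat) (u : 'I_q -> A).
Hypothesis hcos : forall a, C a -> exists i, B (a - u i).

Let bb : is_basis bar. Proof. by case: hFA. Qed.
Let hK : comm_subdomain (subalg bar B : set FA^c).
Proof. exact: (tga_comm_subdomain hFA hA hB hcomm). Qed.

(** Coefficients stand on the right because they act as left scalars over [FA^c]. *)
Lemma subalg_cosets (y : FA) : subalg bar C y ->
  exists c : 'I_q -> FA, (forall i, subalg bar B (c i)) /\ y = \sum_i bar (u i) * c i.
Proof.
move: y; apply: (subalg_ind bb) => [|x y [c [Kc ->]] [d [Kd ->]]|l a Ca].
- exists (fun=> 0); split=> [i|]; first exact: subalg0.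
  by rewrite big1 // => i _; rewrite mulr0.
- exists (fun i => c i + d i); split=> [i|]; first exact: subalgD.
  by rewrite -big_split; apply: eq_bigr => i _; rewrite mulrDr.
have [i Bi] := hcos Ca.
exists (fun j => if j == i then (l / tau (u i) (a - u i)) *: bar (a - u i) else 0).
split=> [j|].
  by case: ifP => _; [apply: subalgZ => //; exact: subalg_bar|exact: subalg0].
rewrite (bigD1 i) //= eqxx big1 ?addr0; last by move=> j /negPf ->; rewrite mulr0.
by rewrite -scalerAr (barM hFA) scalerA divfK ?(tau_neq0 hFA) // addrC subrK.
Qed.

(** As long as the constant term vanishes, x cancels on the left and the relation gets shorter; a
    nonzero constant term is a right multiple of x. *)
Lemma power_relation (x : FA) l (z : 'I_l -> FA) : x <> 0 ->
  (forall i, subalg bar B (z i)) -> (exists i, z i <> 0) ->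
  \sum_(i < l) x ^+ i * z i = 0 ->
  exists y w, [/\ subalg bar B y, y <> 0 & y = x * w].
Proof.
move=> x0; elim: l z => [|l IH] z Kz [i zi]; first by case: i zi.
rewrite big_ord_recl expr0 mul1r.
under eq_bigr do rewrite lift0 exprS -mulrA.
rewrite -mulr_sumr; set w := \sum_(_ < _) _ => zw.
have [z0|z0] := pselect (z ord0 = 0); last first.
  exists (z ord0), (- w); split=> //.
  by apply/eqP; rewrite mulrN -addr_eq0 zw.
have w0 : w = 0 by move: zw; rewrite z0 add0r => /(tga_domain hFA hA) [].
apply: (IH (fun i => z (lift ord0 i))) => //.
by case: (unliftP ord0 i) zi => [j ->|-> //] zj; exists j.
Qed.

(* [x] is algebraic over the commutative subalgebra [F * B], over which
   [F * C] has finite rank. *)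
Lemma subalg_multiple (x : FA) : subalg bar C x -> x <> 0 ->
  exists y w, [/\ subalg bar B y, y <> 0 & y = x * w].
Proof.
move=> Cx x0.
have Cxn n : subalg bar C (x ^+ n).
  elim: n => [|n IH]; first exact: (subalg1 hFA hC.1).
  by rewrite exprS; apply: (subalgM hFA).
(* In the regular module [(FA^c)^o] scalars multiply on the right in FA, so q + 1 powers of x lie in
   the span of q elements. *)
have span (i : 'I_q.+1) : fspan (subalg bar B : set FA^c)
    (fun j => bar (u j) : (FA^c)^o) (x ^+ i).
  by have [c [Kc ->]] := subalg_cosets (Cxn i); exists c.
have [|z [Kz z0 hz]] := fspan_dep hK _ span; first by rewrite card_ord.
exact: (power_relation x0 Kz z0 hz).
Qed.

End Cosets.

Section CyclicModule.
Variables (F : fieldType) (A : zmodType) (FA : algType F).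
Variables (bar : A -> FA) (tau : A -> A -> F) (M : lmodType FA^c) (B : set A).
Hypotheses (hFA : twisted_group_algebra bar tau) (hA : fg_free_abelian A).
Hypothesis hcenter : alg_center FA = scalars FA.
Hypothesis hB : is_subgroup B.
Hypothesis hcomm : forall x y : FA, subalg bar B x -> subalg bar B y -> x * y = y * x.
Variables (k : nat) (m : 'I_k -> M).
Hypothesis hm : fspan (subalg bar B : set FA^c) m = setT.
Hypothesis hA0 : exists a : A, a <> 0.

Let bb : is_basis bar. Proof. by case: hFA. Qed.
Let hK : comm_subdomain (subalg bar B : set FA^c).
Proof. exact: (tga_comm_subdomain hFA hA hB hcomm). Qed.

(** With a of infinite order modulo B, the k + 1 elements t [bar (a *+ i)] are dependent over F * B.
    The relation reads t r = 0, where the terms of r are supported in distinct cosets of B. *)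
Lemma ex_annihilator (t : M) : exists2 r : FA, r <> 0 & ract t r = 0.
Proof.
have [a ha] := ex_infinite_order hFA hA hcenter hB hcomm hA0.
have cos i j : i <> j -> ~ B (a *+ i - a *+ j).
  wlog ij : i j / (j < i)%N.
    move=> h /eqP; rewrite neq_ltn => /orP[ij|ji] Bij.
      apply: (h j i) => //; first by move=> ji; rewrite ji ltnn in ij.
      by rewrite -opprB; exact: subgroupN.
    by apply: (h i j) => // ij; rewrite ij ltnn in ji.
  by move=> _; rewrite -mulrnBr ?(ltnW ij) //; apply: ha; rewrite subn_gt0.
pose v (i : 'I_k.+1) := ract t (bar (a *+ i)).
have [x [Kx [i0 xi0] hx]] : exists x : 'I_k.+1 -> FA, [/\ (forall i, subalg bar B (x i)),
    (exists i, x i <> 0) & \sum_i ract (v i) (x i) = 0].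
  by apply: (fspan_dep hK (m := m)) => [|i]; rewrite ?card_ord ?hm.
exists (\sum_(i < k.+1) bar (a *+ i) * x i); last first.
  by rewrite ract_sumr -[RHS]hx; apply: eq_bigr => i _; rewrite ractM.
have [c xc] := bcoef_neq0 bb xi0.
(* Only the term of index [i0] can contribute to this coefficient. *)
move=> /(congr1 (fun y => bcoef bar y (a *+ i0 + c))).
rewrite bcoef0 // bcoef_sum // (bigD1 i0) //= (bcoef_barM hFA) big1 => [|i ii0].
  by move/eqP; rewrite addr0 mulf_eq0 (negPf (tau_neq0 hFA _ _)) (negPf xc).
have -> : a *+ i0 + c = a *+ i + (a *+ i0 - a *+ i + c) by rewrite addrA [_ + (_ - _)]addrC subrK.
rewrite (bcoef_barM hFA); have [->|xi] := eqVneq (bcoef bar (x i) (a *+ i0 - a *+ i + c)) 0.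
  by rewrite mulr0.
have Bc : B c by move/(subalgP bb): (Kx i0); exact.
have Bi : B (a *+ i0 - a *+ i + c) by move/(subalgP bb): (Kx i); exact.
case: (cos i0 i); first by move/val_inj => ii; rewrite ii eqxx in ii0.
by rewrite -(addrK c (_ - _)); exact: hB.2.
Qed.

(** This is the simplicity of F * A: the elements sending N' into N form an ideal stable under
    conjugation, so if r were among them, 1 would be too. *)
Lemma faithful_factor (N N' : set M) (r : FA) :
  is_submodule N -> is_submodule N' -> ~ (N' `<=` N) -> r <> 0 ->
  exists2 s, N' s & ~ N (ract s r).
Proof.
move=> hN hN' NN' r0; apply: contrapT => h; apply: NN'.
have [N0 ND NZ] := hN.
pose J := [set x : FA | forall s, N' s -> N (ract s x)].
have hsetT : is_subgroup [set: A] by [].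
have J1 : J 1.
  apply: (invariant_ideal_unit hFA (B := setT) (J := J) hcenter hsetT _ _ _ _ _ (x := r)) => //.
  - by move=> x _; exact: subalg_full.
  - move=> x y hx hy s Ns; rewrite ractBr -scaleN1r; apply: ND; first exact: hx.
    by apply: NZ; exact: hy.
  - by move=> l x hx s Ns; rewrite ractZr; apply: submodule_ract => //; exact: hx.
  - by move=> x b hx _ s Ns; rewrite ractM; apply: submodule_ract => //; exact: hx.
  - move=> a x hx s Ns; rewrite /bar_conj 2!ractM; apply: submodule_ract => //; apply: hx.
    exact: submodule_ract.
  - by move=> s Ns; apply: contrapT => nN; apply: h; exists s.
by move=> s /J1; rewrite ract1.
Qed.

(** [P i] asks for a generator of M modulo [N i]. It is trivial for i = l and is carried down to i =
    0. *)
Lemma cyclic_of_finite_length : finite_length M -> cyclic_module M.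
Proof.
move=> [l [N [N0 Nl hN hs]]].
pose P i := exists t, forall v, exists x, N i (v - ract t x).
have step i : (i < l)%N -> P i.+1 -> P i.
  move=> il [t ht]; have [sN nN maxN] := hs i il.
  have hNi := hN i (ltnW il); have hNi' := hN i.+1 il.
  have [Ni0 NiD NiZ] := hNi; have [_ NiD' NiZ'] := hNi'.
  have [r r0 tr] := ex_annihilator t.
  have [|s Ns Nsr] := faithful_factor hNi hNi' _ r0.
    by move=> Ns; apply: nN; exact/seteqP.
  (* Q lies between [N i] and [N i.+1] and contains s r, which equals (t + s) r; by maximality it is
     all of [N i.+1]. *)
  pose Q := [set v | N i.+1 v /\ exists x, N i (v - ract (t + s) x)].
  have hQ : is_submodule Q.
    split.
    - by split; [case: hNi'|exists 0; rewrite ract0 subr0].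
    - move=> v w [Nv [x hx]] [Nw [y hy]]; split; first exact: NiD'.
      by exists (x + y); rewrite ractDr opprD addrACA; exact: NiD.
    - move=> a v [Nv [x hx]]; split; first exact: NiZ'.
      exists (x * a); rewrite ractM -[a *: v]/(ract v a) /ract -scalerBr.
      exact: NiZ.
  have QE : Q = N i.+1.
    have [||//|//] := maxN Q hQ.
    - by move=> v Nv; split; [exact: sN|exists 0; rewrite ract0 subr0].
    - by move=> v [].
    move=> QN; case: Nsr; rewrite -QN; split; first exact: submodule_ract.
    by exists r; rewrite ractDl tr add0r subrr.
  have [_ [y hy]] : Q s by rewrite QE.
  exists (t + s) => v; have [x hx] := ht v; rewrite -QE in hx.
  (* Modulo [N i], v is t x + (t + s) z, while t x = (t + s) x - s x and s is (t + s) y. *)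
  have [_ [z hz]] := hx; exists (z + x - y * x).
  have -> : v - ract (t + s) (z + x - y * x) =
      (v - ract t x - ract (t + s) z) - ract (s - ract (t + s) y) x.
    have -> : ract (s - ract (t + s) y) x = ract s x - ract (t + s) (y * x).
      by rewrite ractM; exact: scalerBr.
    rewrite ractBr ractDr [ract (t + s) x]ractDl !opprD !opprK !addrA.
    by congr (_ + _ + _); rewrite addrAC.
  apply: NiD => //; rewrite -scaleN1r; apply: NiZ; exact: submodule_ract.
have [t ht] : P 0%N.
  have : forall d, (d <= l)%N -> P (l - d)%N.
    elim=> [_|d IH dl]; first by rewrite subn0; exists 0 => v; exists 0; rewrite Nl.
    apply: step; first by rewrite ltn_subrL /= (leq_trans _ dl).
    by rewrite subnSK //; apply: IH; exact: ltnW.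
  by move=> /(_ l (leqnn _)); rewrite subnn.
exists t; apply/seteqP; split=> // v _; have [x] := ht v; rewrite N0 => /eqP.
rewrite subr_eq0 => /eqP ->; exists [:: (x : FA^c, t)]; rewrite big_seq1; split=> //.
by move=> p; rewrite inE => /eqP ->.
Qed.

End CyclicModule.

(** * Growth *)

Section Growth.
Variables (F : fieldType) (A : zmodType) (FA : algType F).
Variables (bar : A -> FA) (tau : A -> A -> F) (M : lmodType FA^c) (B : set A).
Hypotheses (hFA : twisted_group_algebra bar tau) (hA : fg_free_abelian A).
Variables (k : nat) (m : 'I_k -> M).
Hypothesis hm : fspan (subalg bar B : set FA^c) m = setT.
Variables (r : nat) (c : 'I_r -> A).
Hypotheses (hc : zindep c) (hBc : forall a, B a <-> exists z, a = zcomb c z).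

Let bb : is_basis bar. Proof. by case: hFA. Qed.

Definition box (b : nat) : set A :=
  [set a | exists z : 'I_r -> int, (forall i, `|z i| <= b%:Z) /\ a = zcomb c z].

Lemma boxD b b' a a' : box b a -> box b' a' -> box (b + b') (a + a').
Proof.
move=> [z [hz ->]] [z' [hz' ->]]; exists (fun i => z i + z' i); split; last exact: zcombD.
by move=> i; rewrite PoszD (le_trans (ler_normD _ _)) // lerD.
Qed.

Lemma boxS b b' : (b <= b')%N -> box b `<=` box b'.
Proof.
move=> bb' _ [z [hz ->]]; exists z; split=> // i.
by rewrite (le_trans (hz i)).
Qed.

Lemma ex_box a : B a -> exists b, box b a.
Proof.
move=> /hBc [z ->]; exists (\sum_i `|z i|)%N; exists z; split=> // i.
by rewrite (bigD1 i) //= PoszD abszE lerDl.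
Qed.

(** An exhaustive filtration of M by subspaces of finite dimension over F. *)
Definition boxspan (b : nat) : set M :=
  [set v | exists x : 'I_k -> FA,
     (forall j, subalg bar (box b) (x j)) /\ v = \sum_j ract (m j) (x j)].

Lemma boxspanS b b' : (b <= b')%N -> boxspan b `<=` boxspan b'.
Proof.
by move=> lebb' _ [x [hx ->]]; exists x; split=> // j; exact: (subalgS bb (boxS lebb') (hx j)).
Qed.

Lemma boxspan0 b : boxspan b 0.
Proof.
exists (fun=> 0); split=> [j|]; first exact: subalg0.
by rewrite big1 // => j _; rewrite ract0.
Qed.

Lemma boxspanD b u v : boxspan b u -> boxspan b v -> boxspan b (u + v).
Proof.
move=> [x [hx ->]] [y [hy ->]]; exists (fun j => x j + y j); split=> [j|].
  exact: subalgD.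
by rewrite -big_split; apply: eq_bigr => j _; rewrite ractDr.
Qed.

Lemma boxspan_sum b (I : Type) (s : seq I) (P : pred I) (f : I -> M) :
  (forall i, P i -> boxspan b (f i)) -> boxspan b (\sum_(i <- s | P i) f i).
Proof. by move=> h; elim/big_rec: _ => [|i x /h]; [exact: boxspan0|exact: boxspanD]. Qed.

Lemma boxspanM b b' v x : boxspan b v -> subalg bar (box b') x ->
  boxspan (b + b') (ract v x).
Proof.
move=> [y [hy ->]] hx; exists (fun j => y j * x); split=> [j|].
  by apply: (subalgM_add hFA _ (hy j) hx); exact: boxD.
by rewrite ract_suml; apply: eq_bigr => j _; rewrite ractM.
Qed.

Lemma boxspanZ b v l : boxspan b v -> boxspan b (ract v l%:A).
Proof.
move=> [y [hy ->]]; exists (fun j => l *: y j); split=> [j|]; first exact: subalgZ.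
by rewrite ract_suml; apply: eq_bigr => j _; rewrite ractZr.
Qed.

Lemma ex_boxspan v : exists b, boxspan b v.
Proof.
have : fspan (subalg bar B : set FA^c) m v by rewrite hm.
move=> [x [Kx ->]].
have ex_b j : exists b, subalg bar (box b) (x j).
  move: (x j) (Kx j); apply: (subalg_ind bb).
  - by exists 0%N; exact: subalg0.
  - move=> y z [b hb] [b' hb']; exists (b + b')%N; apply: subalgD => //.
      by apply: (subalgS bb (boxS _) hb); exact: leq_addr.
    by apply: (subalgS bb (boxS _) hb'); exact: leq_addl.
  - by move=> l a /ex_box [b ab]; exists b; apply: subalgZ => //; exact: subalg_bar.
have [b hb] := choice ex_b.
exists (\sum_j b j)%N, x; split=> // j; apply: (subalgS bb (boxS _) (hb j)).
by rewrite (bigD1 j) //= leq_addr.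
Qed.

(* Conjugation by [bar a] preserves supports, so right multiplication by a fixed
   element of [F * A] enlarges the boxes by a bounded amount only. *)
Lemma ract_boxspan x : exists b', forall b v, boxspan b v -> boxspan (b + b') (ract v x).
Proof.
move: x (subalg_full bb x); apply: (subalg_ind bb).
- by exists 0%N => b v _; rewrite ract0; exact: boxspan0.
- move=> x y [b1 h1] [b2 h2]; exists (b1 + b2)%N => b v hv; rewrite ractDr; apply: boxspanD.
    by apply: boxspanS (h1 _ _ hv); rewrite leq_add2l leq_addr.
  by apply: boxspanS (h2 _ _ hv); rewrite leq_add2l leq_addl.
move=> l a _; have [b' hb'] := choice (fun j => ex_boxspan (ract (m j) (bar a))).
exists (\sum_j b' j)%N => b v [x [hx ->]]; rewrite ractZr; apply: boxspanZ.
rewrite ract_suml; apply: boxspan_sum => j _.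
(* Moving [bar a] to the left of [x j] leaves the fixed vector [m j] [bar a], acted on by a
   conjugate with the same support. *)
rewrite -ractM -(mul_bar_conj hFA) ractM addnC; apply: boxspanM; last exact: (subalg_conj hFA).
by apply: boxspanS (hb' j); rewrite (bigD1 j) //= leq_addr.
Qed.

(** Each factor V enlarges the box by at most b1, the sum of the constants of finitely many spanning
    elements of V. *)
Lemma iter_subspace_mul_box (V : set FA) (W : set M) :
  fin_gen (setT : set F) V -> fin_gen (scalars FA : set FA^c) W ->
  exists b0 b1, forall n,
    iter n (fun U => subspace_mul U V) W `<=` boxspan (b0 + n * b1).
Proof.
move=> hV hW; have hs := scalars_comm_subdomain hFA hA.
have [p [w ->]] : exists p (w : 'I_p -> FA), V = fspan setT w by exact: fin_gen_fspan.
have [p' [w' ->]] := fin_gen_fspan (subdom0 hs) (subdomD hs) hW.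
have [b0 hb0] := choice (fun j => ex_boxspan (w' j)).
have [b1 hb1] := choice (fun j => ract_boxspan (w j)).
exists (\sum_j b0 j)%N, (\sum_j b1 j)%N; elim=> [|n IH].
  move=> _ [d [Sd ->]]; apply: boxspan_sum => j _; have [l _ <-] := Sd j.
  apply: (@boxspanZ _ (w' j) l); apply: boxspanS (hb0 j).
  by rewrite addn0 (bigD1 j) //= leq_addr.
apply: lin_span_ind; [exact: boxspan0|exact: boxspanD|].
move=> _ _ [l _ <-] [v [x [/IH hv [d [_ ->]] ->]]]; apply: (@boxspanZ _ _ l).
rewrite ract_sumr; apply: boxspan_sum => j _; rewrite ractZr; apply: boxspanZ.
apply: boxspanS (hb1 j _ _ hv); rewrite mulSn addnCA addnC leq_add2r.
by rewrite (bigD1 j) //= leq_addr.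
Qed.

Lemma vdim_boxspan (R : realType) b :
  (vdim R (scalars FA : set FA^c) (boxspan b) <= ((k * (b.*2.+1) ^ r)%N%:R)%:E)%E.
Proof.
have hs := scalars_comm_subdomain hFA hA.
pose T : finType := ('I_k * {ffun 'I_r -> 'I_(b.*2.+1)})%type.
(* Coordinates from -b to b are encoded as 0, ..., 2b. *)
pose g (p : T) : M := ract (m p.1) (bar (zcomb c (fun i => (p.2 i)%:Z - b%:Z))).
have -> : (k * (b.*2.+1) ^ r)%N = #|T| by rewrite card_prod card_ffun !card_ord.
apply: (@vdim_le _ _ hs _ _ _ g) => _ [x [hx ->]].
apply: fspan_sum; [exact: subdom0 hs|exact: subdomD hs|move=> j _].
have S0 := subdom0 hs; have SD := subdomD hs.
move: (x j) (hx j); apply: (subalg_ind bb).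
- by rewrite ract0; exact: fspan0.
- by move=> y z; rewrite ractDr; exact: fspanD.
move=> l _ [z [hz ->]].
have zb i : (absz (z i + b%:Z)%R < b.*2.+1)%N.
  have := hz i; rewrite ler_norml => /andP[zl zu].
  rewrite -ltz_nat gez0_abs; last by rewrite -lerBlDr sub0r.
  by rewrite -addnn -addn1 !PoszD ltzD1 lerD2r.
pose f : {ffun 'I_r -> 'I_(b.*2.+1)} := [ffun i => Ordinal (zb i)].
have -> : ract (m j) (l *: bar (zcomb c z)) = (l%:A : FA^c) *: g (j, f).
  rewrite ractZr /g /=; congr (ract (ract _ (bar _)) _); apply: eq_bigr => i _.
  rewrite ffunE /= gez0_abs ?addrK //.
  by have := hz i; rewrite ler_norml => /andP[zl _]; rewrite -lerBlDr sub0r.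
by apply: fspan_term => //; exists l.
Qed.

End Growth.

(** * Upper limits of logarithmic quotients *)

Section LimSup.
Variable R : realType.

Lemma limn_esup_ge (u : nat -> \bar R) (l : \bar R) (N : nat) :
  (forall n, (N <= n)%N -> (l <= u n)%E) -> (l <= limn_esup u)%E.
Proof.
move=> h; apply: le_ereal_inf_tmp => _ [V [n _ nV] <-].
apply: (@le_trans _ _ (u (maxn n N))); first by apply: h; exact: leq_maxr.
apply: ereal_sup_ubound; exists (maxn n N) => //; apply: nV; exact: leq_maxl.
Qed.

Lemma limn_esup_le (u : nat -> \bar R) (l : \bar R) (N : nat) :
  (forall n, (N <= n)%N -> (u n <= l)%E) -> (limn_esup u <= l)%E.
Proof.
move=> h; have : ([set ereal_sup (u @` V) | V in \oo] (ereal_sup (u @` [set n | (N <= n)%N]))).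
  by exists [set n | (N <= n)%N] => //; exists N.
move=> /ereal_inf_lbound /le_trans; apply; apply: ge_ereal_sup => _ [n Nn <-]; exact: h.
Qed.

Lemma limn_esup_log_le (u : nat -> \bar R) (D r : nat) : (0 < D)%N ->
  (forall n, (1 < n)%N -> (u n <= (ln ((D * n ^ r)%N%:R) / ln n%:R)%:E)%E) ->
  (limn_esup u <= (r%:R)%:E)%E.
Proof.
move=> D0 h; apply/lee_addgt0Pr => e e0.
(* The quotient is r + ln D / ln n, and its second term is at most e once n reaches this x. *)
pose x : R := expR (ln D%:R / e).
apply: (@limn_esup_le _ _ (maxn 2 (Num.truncn x).+1)) => n.
rewrite geq_max => /andP[n1 xn]; apply: le_trans (h n n1) _; rewrite -EFinD lee_fin.
have n0 : 0 < n%:R :> R by rewrite ltr0n ltnW.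
have ln0 : 0 < ln n%:R :> R by rewrite ln_gt0 // ltr1n.
rewrite natrM natrX lnM ?posrE ?ltr0n // ?exprn_gt0 // lnXn //.
rewrite ler_pdivrMr // mulrDl mulr_natl addrC lerD2l.
rewrite mulrC -ler_pdivrMr // -[leLHS]expRK ler_ln ?posrE ?expR_gt0 //.
by apply: ltW; apply: lt_le_trans (truncnS_gt _) _; rewrite ler_nat.
Qed.

End LimSup.

(** * Bounds for the Gelfand-Kirillov dimension *)

Section GKdim.
Variables (F : fieldType) (A : zmodType) (FA : algType F).
Variables (bar : A -> FA) (tau : A -> A -> F) (M : lmodType FA^c) (B : set A).
Hypotheses (hFA : twisted_group_algebra bar tau) (hA : fg_free_abelian A).
Variables (k : nat) (m : 'I_k -> M).
Hypothesis hm : fspan (subalg bar B : set FA^c) m = setT.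
Variables (r : nat) (c : 'I_r -> A).
Hypotheses (hc : zindep c) (hBc : forall a, B a <-> exists z, a = zcomb c z).

Let bb : is_basis bar. Proof. by case: hFA. Qed.

Lemma GKdim_le (R : realType) : (GKdim M R <= (r%:R)%:E)%E.
Proof.
apply: ge_ereal_sup => _ [V [W [hV _ hW ->]]].
have [b0 [b1 hVW]] := iter_subspace_mul_box hFA hA hm hBc hV hW.
(* For n at least 1, 2 (b0 + n b1) + 1 is at most n (2 (b0 + b1) + 1); k + 1 in place of k keeps D
   positive. *)
pose D := (k.+1 * ((b0 + b1).*2.+1) ^ r)%N.
apply: (@limn_esup_log_le _ _ D); first by rewrite muln_gt0 expn_gt0.
move=> n n1; have n0 := ltnW n1.
have hle : (vdim R (scalars FA : set FA^c) (iter n (fun U => subspace_mul U V) W)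
    <= ((D * n ^ r)%N%:R)%:E)%E.
  apply: (@le_trans _ _ (vdim R (scalars FA : set FA^c) (boxspan bar m c (b0 + n * b1)))).
    apply: ge_ereal_sup => _ [i [v [hv iv ->]]]; apply: vdim_ge iv => j.
    exact/hVW/hv.
  apply: (le_trans (vdim_boxspan hFA hA m c R _)); rewrite lee_fin ler_nat.
  have leq_exp a b e : (a <= b -> a ^ e <= b ^ e)%N.
    by case: e => [|e] ab; rewrite ?expn0 // leq_exp2r.
  rewrite /D -mulnA -expnMn; apply: leq_mul => //; apply: leq_exp.
  rewrite mulSn -doubleMl mulnDl -add1n leq_add // leq_double [(b1 * n)%N]mulnC leq_add2r.
  exact: leq_pmulr.
set v := vdim _ _ _ in hle *.
have v0 : (0 <= v)%E.
  by have := @vdim_ge R _ _ (scalars FA : set FA^c)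
    (iter n (fun U => subspace_mul U V) W) 0 (fun=> 0) _ _; apply => [[]|s x _ _ _ []].
have Dn0 : (0 < D * n ^ r)%N by rewrite !muln_gt0 !expn_gt0 n0.
have ln0 : 0 < ln n%:R :> R by rewrite ln_gt0 // ltr1n.
rewrite EFinM lee_wpmul2r ?lee_fin ?invr_ge0 ?(ltW ln0) //.
by rewrite -lne_EFin ?ltr0n // lee_lne // in_itv /= leey andbT // lee_fin ler0n.
Qed.

(** Take W = F t and V spanned by the [bar] images of the unit cube on the basis c. Then W V^n
    contains t times every basis element with coordinates from 0 to n, and these are independent
    because no nonzero element of F * B kills t. *)
Lemma GKdim_ge (R : realType) (t : M) : 
  (forall x : FA, subalg bar B x -> x <> 0 -> ract t x <> 0) ->
  ((r%:R)%:E <= GKdim M R)%E.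
Proof.
move=> ht; have hs := scalars_comm_subdomain hFA hA.
pose g (f : {ffun 'I_r -> bool}) := bar (zcomb c (fun i => (f i)%:Z)).
pose V := lin_span (setT : set F) (range g).
pose W := lin_span (scalars FA : set FA^c) [set t].
have V1 : V 1.
  exists [:: ((tau 0 0)^-1, g [ffun=> false])]; rewrite big_seq1; split=> [p|].
    by rewrite inE => /eqP ->; split=> //; eexists.
  rewrite /= /g /zcomb big1 ?(bar0 hFA) => [|i _]; last by rewrite ffunE.
  by rewrite scalerA mulVf ?scale1r // (tau_neq0 hFA).
have hV : fin_gen (setT : set F) V by exists (range g) => //; exact: finite_image.
have hW : fin_gen (scalars FA : set FA^c) W by exists [set t].
apply: (@le_trans _ _ (growth R W V)); last by apply: ereal_sup_ubound; exists V, W.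
pose b (z : 'I_r -> nat) := bar (zcomb c (fun i => (z i)%:Z)).
have span_one (X : set M) l u : X u ->
    lin_span (scalars FA : set FA^c) X (ract u l%:A).
  move=> Xu; exists [:: (l%:A : FA^c, u)]; rewrite big_seq1; split=> // p.
  by rewrite inE => /eqP ->; split=> //; exists l.
have hb n z : (forall i, (z i <= n)%N) ->
    iter n (fun U => subspace_mul U V) W (ract t (b z)).
  elim: n z => [|n IH] z hz.
    have -> : b z = (tau 0 0)%:A.
      rewrite /b /zcomb big1 ?(bar0 hFA) // => i _.
      by have := hz i; rewrite leqn0 => /eqP ->.
    exact: span_one.
  (* Coordinates equal to n + 1 are lowered to n, and f records where; the last factor V restores
     them. *)
  pose z' i := minn (z i) n.
  pose f : {ffun 'I_r -> bool} := [ffun i => (n < z i)%N].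
  have zE : zcomb c (fun i => (z' i)%:Z) + zcomb c (fun i => (f i)%:Z) =
      zcomb c (fun i => (z i)%:Z).
    rewrite zcombD; apply: eq_bigr => i _; rewrite ffunE -PoszD; congr (_ *~ Posz _).
    rewrite /z' /minn; case: (ltngtP (z i) n) => [||->] /=; rewrite ?addn0 // => zn.
    by apply/eqP; rewrite addn1 eqn_leq zn hz.
  pose l := tau (zcomb c (fun i => (z' i)%:Z)) (zcomb c (fun i => (f i)%:Z)).
  have -> : ract t (b z) = ract (ract (ract t (b z')) (g f)) (l^-1)%:A.
    rewrite -!ractM ?mulrA; congr ract; rewrite /b /g (barM hFA) zE.
    by rewrite -scalerAr mulr1 scalerA mulVf ?scale1r // (tau_neq0 hFA).
  apply: span_one; exists (ract t (b z')), (g f); split=> //.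
    by apply: IH => i; exact: geq_minr.
  exists [:: (1, g f)]; rewrite big_seq1 scale1r; split=> // p.
  by rewrite inE => /eqP ->; split=> //; exists f.
apply: (@limn_esup_ge _ _ _ 2) => n n1.
have n0 : 0 < n%:R :> R by rewrite ltr0n ltnW.
have ln0 : 0 < ln n%:R :> R by rewrite ln_gt0 // ltr1n.
have -> : ((r%:R)%:E = lne ((n ^ r)%N%:R)%:E * ((ln n%:R)^-1)%:E :> \bar R)%E.
  rewrite lne_EFin ?ltr0n ?expn_gt0 ?(ltnW n1) // -EFinM natrX lnXn // -[ln _ *+ _]mulr_natl.
  by rewrite mulfK ?gt_eqF.
rewrite lee_wpmul2r ?lee_fin ?invr_ge0 ?(ltW ln0) //.
set d := vdim _ _ _.
have hd : (((n ^ r)%N%:R)%:E <= d)%E.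
  (* Coordinates below n already give n^r independent vectors, for which the logarithmic quotient is
     exactly r. *)
  pose T := {ffun 'I_r -> 'I_n}.
  have -> : (n ^ r)%N = #|T| by rewrite card_ffun !card_ord.
  pose z (j : 'I_#|T|) : 'I_r -> int := fun i => (enum_val j i : nat)%:Z.
  have z_inj : injective (fun j => zcomb c (z j)).
    move=> i j /(zindep_inj hc) zij; apply: enum_val_inj; apply/ffunP => l.
    by have := congr1 (fun h => h l) zij => -[] /val_inj.
  apply: (@vdim_ge _ _ _ _ _ _ (fun j => ract t (bar (zcomb c (z j))))) => [j|].
    by apply: (hb n (fun i => enum_val j i)) => i; exact: ltnW.
  apply/lin_indepP => [|x Sx hx i]; first exact: subdom0 hs.
  have [l hl] := choice (fun j => let: ex_intro2 l _ lE := Sx j in ex_intro _ l lE).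
  pose y : FA := \sum_j l j *: bar (zcomb c (z j)).
  have ty : ract t y = 0.
    rewrite -[RHS]hx /y ract_sumr; apply: eq_bigr => j _.
    by rewrite ractZr -hl.
  have By : subalg bar B y.
    apply: subalg_sum => // j _; apply: subalgZ => //; apply: subalg_bar => //.
    by apply/hBc; exists (z j).
  have y0 : y = 0 by apply: contrapT => y0; exact: (ht y By y0).
  have := congr1 (fun w => bcoef bar w (zcomb c (z i))) y0.
  rewrite bcoef0 // bcoef_sum // (bigD1 i) //= bcoefZbar // eqxx big1 => [|j ji].
    by rewrite addr0 mulr1n -hl => ->; rewrite scale0r.
  by rewrite bcoefZbar // (inj_eq z_inj) eq_sym (negPf ji).
have nr0 : (0 <= ((n ^ r)%N%:R)%:E :> \bar R)%E by rewrite lee_fin ler0n.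
by rewrite lee_lne // in_itv /= leey andbT //; exact: le_trans hd.
Qed.

End GKdim.

(** * The theorem *)

(** Products of the generators over F * C with [bar] of coset representatives generate over F *
    B. *)
Lemma fin_gen_finite_index (F : fieldType) (A : zmodType) (FA : algType F)
    (bar : A -> FA) (tau : A -> A -> F) (M : lmodType FA^c) (C B : set A) :
  twisted_group_algebra bar tau -> is_subgroup C -> is_subgroup B ->
  B `<=` C -> finite_index C B ->
  fin_gen (subalg bar C : set FA^c) [set: M] ->
  exists k (m : 'I_k -> M), fspan (subalg bar B : set FA^c) m = setT.
Proof.
move=> hFA hC hB hBC hfin hM; have bb : is_basis bar by case: hFA.
have [q [u hcos]] := finite_index_reps hB hfin.
have [p [w wE]] := fin_gen_fspan (subalg0 bb C : (subalg bar C : set FA^c) 0)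
  (fun x y => @subalgD _ _ _ _ bb C x y) hM.
exists #|{: 'I_p * 'I_q}|,
  (fun i => ract (w (enum_val i).1) (bar (u (enum_val i).2))).
apply/seteqP; split=> // v _.
have : fspan (subalg bar C : set FA^c) w v by rewrite -wE.
have S0 : (subalg bar B : set FA^c) 0 by exact: subalg0.
have SD (x y : FA^c) : subalg bar B x -> subalg bar B y -> subalg bar B (x + y).
  exact: subalgD.
move=> [x [Cx ->]]; apply: fspan_sum => // j _.
have [c [Bc xE]] := subalg_cosets hFA hcos (Cx j).
rewrite -[_ *: _]/(ract (w j) (x j)) xE ract_sumr; apply: fspan_sum => // i _.
rewrite ractM.
have := @fspan_term _ M _ S0 _ (fun i => ract (w (enum_val i).1) (bar (u (enum_val i).2)))
  (c i) (enum_rank (j, i)) (Bc i).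
by rewrite enum_rankK.
Qed.

Theorem theorem4p1 (R : realType) (F : fieldType) (A : zmodType)
    (FA : algType F) (bar : A -> FA) (tau : A -> A -> F)
    (M : lmodType FA^c) (C C0 : set A)
    (hA : fg_free_abelian A)
    (hFA : twisted_group_algebra bar tau)
    (hcenter : alg_center FA = scalars FA)
    (hM0 : exists m : M, m != 0)
    (hMfg : fin_gen setT [set: M])
    (hC : is_subgroup C) (hCA : C <> setT)
    (hC0 : is_subgroup C0) (hC0C : C0 `<=` C) (hfin : finite_index C C0)
    (hcomm : forall x y : FA, subalg bar C0 x -> subalg bar C0 y -> x * y = y * x)
    (hMC : fin_gen (subalg bar C : set FA^c) [set: M]) :
  [/\ GKdim M R = rk R C,
      torsion_free M (subalg bar C),
      finite_length M
    & cyclic_module M].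
Proof.
have bb : is_basis bar by case: hFA.
have [r [c [ic hc]]] := subgroup_basis hA hC0.
have [k [m hm]] := fin_gen_finite_index hFA hC hC0 hC0C hfin hMC.
have [t0 /eqP t00] := hM0.
have tf (t : M) (x : FA) : subalg bar C0 x -> x <> 0 -> ract t x = 0 -> t = 0.
  exact: (torsion0_ksub hFA hA hcenter hC0 hcomm hm).
have hlen : finite_length M := finite_length_of_fg hFA hA hcenter hC0 hcomm hm hM0.
split=> //.
- rewrite (rk_finite_index hC hC0 hC0C hfin R ic hc).
  apply/eqP; rewrite eq_le (GKdim_le hFA hA hm hc) /=.
  by apply: (@GKdim_ge _ _ _ _ _ _ _ hFA hA _ _ ic hc R t0) => x Kx x0 /(tf _ _ Kx x0).
- apply/seteqP; split=> [t [x [Cx /eqP x0 tx]]|_ ->] /=.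
    (* If t x = 0, then t is also killed by a nonzero right multiple y of x lying in F * C0. *)
    have [q [u hcos]] := finite_index_reps hC0 hfin.
    have [y [w [Ky y0 yE]]] := subalg_multiple hFA hA hC0 hC hcomm hcos Cx x0.
    by apply: (tf _ _ Ky y0); rewrite yE ractM tx ract0l.
  by exists 1; split; [exact: (subalg1 hFA hC.1)|exact: oner_neq0|exact: ract0l].
apply: (cyclic_of_finite_length hFA hA hcenter hC0 hcomm hm) => //.
(* A is nonzero because it has a proper subgroup. *)
apply: contrapT => /forallNP h; apply: hCA; apply/seteqP; split=> // a _.
by have -> : a = 0 by [exact: contrapT (h a)]; exact: hC.1.
Qed.
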